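(* Let $\theta>0$ and let $(Z_{ij}: i,j\in\mathbb{Z})$ be a real stationary Gaussian process indexed by $\mathbb{Z}^2$ with mean $\theta$ and covariance kernel $R(i,j)=\mathrm{Cov}(Z_{00},Z_{ij})$, $i,j\in\mathbb{Z}$. Assume $$\sum_{i=-\infty}^{\infty}\sum_{j=-\infty}^{\infty}|R(i,j)|<\infty \quad\text{and}\quad \sum_{i=-\infty}^{\infty}\sum_{j=-\infty}^{\infty}R(i,j)\neq 0.$$ For $N\ge1$ let $A_N$ be the $N\times N$ symmetric random matrix with $A_N(i,j)=Z_{ij}+Z_{ji}$, $1\le i,j\le N$, and let $\lambda_1(A_N)$ be its largest eigenvalue. Then $$\lambda_1(A_N)-2N\theta \Rightarrow N(\alpha,\sigma^2),\qquad N\to\infty,$$ (convergence in distribution to a normal law), where $$\alpha=\frac{1}{2\theta}\sum_{i=-\infty}^{\infty}\big(R(i,0)+R(0,i)\big),\qquad \sigma^2=4\sum_{i=-\infty}^{\infty}\sum_{j=-\infty}^{\infty}R(i,j).$$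
   Context: Stationarity of the Gaussian process means that its law is invariant under shifts $(i,j)\mapsto(i+a,j+b)$ of the index set $\mathbb{Z}^2$, so $\mathrm{Cov}(Z_{ij},Z_{kl})=R(k-i,l-j)$. *)

(* Defs.v *)
From HB Require Import structures.
From mathcomp Require Import all_boot all_order all_algebra.
From mathcomp Require Import all_classical all_reals all_analysis.
Set Implicit Arguments. Unset Strict Implicit. Unset Printing Implicit Defensive.
Import Order.TTheory GRing.Theory Num.Theory.
Import numFieldNormedType.Exports.
Local Open Scope classical_set_scope.
Local Open Scope ring_scope.

Section defs.
Context {d : measure_display} {T : measurableType d} {R : realType}.

Definition gaussian_rv (P : probability T R) (X : T -> R) : Prop :=
  measurable_fun setT X /\
  exists m s : R, forall A : set R, measurable A ->
    P (X @^-1` A) = if s == 0 then \d_m A else normal_prob m s A.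

Definition gaussian_process (P : probability T R) (Z : int -> int -> T -> R) : Prop :=
  forall l : seq ((int * int) * R),
    gaussian_rv P (fun w => \sum_(p <- l) p.2 * Z p.1.1 p.1.2 w).

Definition stationary_mean (P : probability T R) (Z : int -> int -> T -> R)
    (theta : R) : Prop :=
  (forall i j, expectation P (Z i j) = theta%:E) /\
  (forall i j k l, covariance P (Z i j) (Z k l) =
                   covariance P (Z 0 0) (Z (k - i) (l - j))).

Definition cov_kernel (P : probability T R) (Z : int -> int -> T -> R)
    (i j : int) : R := fine (covariance P (Z 0 0) (Z i j)).

Definition AN (Z : int -> int -> T -> R) (N : nat) (w : T) : 'M[R]_N :=
  \matrix_(i < N, j < N)
    (Z (nat_of_ord i).+1%:Z (nat_of_ord j).+1%:Z w
     + Z (nat_of_ord j).+1%:Z (nat_of_ord i).+1%:Z w).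

End defs.

Definition lambda_max {R : realType} {N : nat} (A : 'M[R]_N) : R :=
  sup [set a : R | eigenvalue A a].

Definition zsum {R : realType} (n : nat) (f : int -> R) : R :=
  \sum_(k < (2 * n).+1) f (k%:Z - n%:Z).

Definition abs_summable2 {R : realType} (f : int -> int -> R) : Prop :=
  exists M : R, forall n : nat,
    zsum n (fun i => zsum n (fun j => `|f i j|)) <= M.

(* value of the double sum (well defined under abs_summable2) *)
Definition sum2 {R : realType} (f : int -> int -> R) : R :=
  limn (fun n => zsum n (fun i => zsum n (fun j => f i j))).

Definition sum1 {R : realType} (f : int -> R) : R :=
  limn (fun n => zsum n f).

(* Main.v *)
Require Import Defs.
From HB Require Import structures.
From mathcomp Require Import all_boot all_order all_algebra.
From mathcomp Require Import all_classical all_reals all_analysis.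
From mathcomp Require Import measurable_realfun.
From mathcomp Require Import zify ring lra.
Import Order.TTheory GRing.Theory Num.Theory.
Import numFieldNormedType.Exports.
Local Open Scope classical_set_scope.
Local Open Scope ring_scope.

Set Implicit Arguments.
Unset Strict Implicit.

(** Write [A_N = a e^T e + W] with [a = 2 N theta], [e] the normalized all-ones
vector and [W] the centered symmetric noise.  Testing the equation of the top
eigenvector against [e], [e W] and its component orthogonal to [e] gives
[lambda_1 - a = e.We + |We|^2 / a + o(1)] as soon as the operator norm of [W] is
[o(N)].  Since the entries are jointly Gaussian with absolutely summable
covariances, Isserlis' formula bounds [E |W^2|_F^2] by a constant times [N^3]
(hence [|W| = O(N^(3/4))]) and shows that [|We|^2 / a] concentrates around its
mean, whose limit, a Cesaro mean of partial sums of the kernel, is [alpha].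
The remaining term [e.We] is Gaussian with variance converging to [sigma2], and
Slutsky's lemma concludes. *)

(** * Rayleigh quotients and rank-one perturbation *)

(** The Frobenius norm of [W] is itself of order N, the size of [a], so it cannot serve as the
    operator norm bound. Passing to W^2 gains because |W|^4 <= |W^2|_F^2, whose mean is only O(N^3).
    Since the entries are correlated, all bounds in probability rest on moments of order at most
    four. These come from the density by integration by parts, and only the identity E X^4 = 3 (E
    X^2)^2 on a linear space of variables is kept: polarization recovers Isserlis' formula from it.
    No characteristic function enters: e.We is a finite linear combination of the process, so its
    distribution function is exactly normal once its variance is positive, and continuity of the
    standard normal distribution function carries it to the limit. The limiting variance is a limit
    of variances, hence positive as soon as it is nonzero. The events about [lambda_max] must also
    be shown measurable, by testing Rayleigh quotients on rational vectors. *)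

Section dot_product.
Variables (R : realType) (n : nat).
Implicit Types (u v x y : 'rV[R]_n) (A B : 'M[R]_n) (c : R).

Definition dot u v : R := (u *m v^T) 0 0.

Lemma dotE u v : dot u v = \sum_i u 0 i * v 0 i.
Proof. by rewrite /dot mxE; apply: eq_bigr => i _; rewrite mxE. Qed.

Lemma dotC u v : dot u v = dot v u.
Proof. by rewrite !dotE; apply: eq_bigr => i _; rewrite mulrC. Qed.

Lemma dotDl u v x : dot (u + v) x = dot u x + dot v x.
Proof. by rewrite /dot mulmxDl mxE. Qed.

Lemma dotZl c u v : dot (c *: u) v = c * dot u v.
Proof. by rewrite /dot -scalemxAl mxE. Qed.

Lemma dotDr u v x : dot x (u + v) = dot x u + dot x v.
Proof. by rewrite dotC dotDl ![dot _ x]dotC. Qed.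

Lemma dotZr c u v : dot u (c *: v) = c * dot u v.
Proof. by rewrite dotC dotZl dotC. Qed.

Lemma dotNl u v : dot (- u) v = - dot u v.
Proof. by rewrite -scaleN1r dotZl mulN1r. Qed.

Lemma dotNr u v : dot u (- v) = - dot u v.
Proof. by rewrite dotC dotNl dotC. Qed.

Lemma dot0l u : dot 0 u = 0.
Proof. by rewrite /dot mul0mx mxE. Qed.

Lemma dot_ge0 u : 0 <= dot u u.
Proof. by rewrite dotE sumr_ge0// => i _; rewrite -expr2 sqr_ge0. Qed.

Lemma dot_gt0 u : u != 0 -> 0 < dot u u.
Proof.
move=> u0; rewrite lt_neqAle dot_ge0 andbT eq_sym; apply: contra u0.
rewrite dotE psumr_eq0; last by move=> i _; rewrite -expr2 sqr_ge0.
move=> /allP h; apply/eqP/rowP => i; rewrite mxE.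
by have := h i (mem_index_enum i); rewrite -expr2 sqrf_eq0 => /eqP.
Qed.

Lemma dot_mulmxl A u v : dot (u *m A) v = dot u (v *m A^T).
Proof. by rewrite /dot trmx_mul trmxK mulmxA. Qed.

(** The form of [B] at [x + t *: y] is a quadratic polynomial in t that stays nonnegative. As [B] is
    only semidefinite, its leading coefficient may vanish. *)
Lemma psd_CauchySchwarz B x y : B^T = B -> (forall u, 0 <= dot u (u *m B)) ->
  dot x (y *m B) ^+ 2 <= dot x (x *m B) * dot y (y *m B).
Proof.
move=> Bs Bp.
have sym : dot y (x *m B) = dot x (y *m B) by rewrite dotC dot_mulmxl Bs.
have H t : 0 <= dot x (x *m B) + 2 * t * dot x (y *m B) + t ^+ 2 * dot y (y *m B).
  have := Bp (x + t *: y).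
  rewrite mulmxDl -scalemxAl !(dotDl, dotDr, dotZl, dotZr) sym.
  by congr (_ <= _); ring.
have q0 := Bp y.
move: H q0; move: (dot x (x *m B)) (dot x (y *m B)) (dot y (y *m B)) => p r q H q0.
have [qz|qn] := eqVneq q 0.
  have [->|rn] := eqVneq r 0; first by rewrite qz mulr0 expr0n.
  (* When [q = 0] the polynomial is affine in t; this t gives it the value -1 unless [r = 0]. *)
  have := H (- (p + 1) / (2 * r)); rewrite qz mulr0 addr0.
  have -> : p + 2 * (- (p + 1) / (2 * r)) * r = -1 by field.
  by rewrite ler0N1.
have qp : 0 < q by rewrite lt_neqAle eq_sym qn.
(* The minimizer of the polynomial. *)
have := H (- r / q).
have -> : p + 2 * (- r / q) * r + (- r / q) ^+ 2 * q = (p * q - r ^+ 2) / q by field.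
by rewrite pmulr_lge0 ?invr_gt0// subr_ge0.
Qed.

Lemma CauchySchwarz x y : dot x y ^+ 2 <= dot x x * dot y y.
Proof.
have := @psd_CauchySchwarz 1%:M x y (trmx1 _ _).
by rewrite !mulmx1; apply=> u; rewrite mulmx1 dot_ge0.
Qed.

(** The square of the Frobenius norm: without the root it is a polynomial in the entries, so its
    mean is a sum of mixed moments. *)
Definition frob A : R := \sum_i \sum_j A i j ^+ 2.

Lemma frob_ge0 A : 0 <= frob A.
Proof. by do 2 apply: sumr_ge0 => ? _; exact: sqr_ge0. Qed.

Lemma frob_bound A x : dot (x *m A) (x *m A) <= frob A * dot x x.
Proof.
rewrite dotE /frob exchange_big mulr_suml; apply: ler_sum => j _ /=.
have -> : (x *m A) 0 j = dot x (col j A)^T.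
  by rewrite dotE mxE; apply: eq_bigr => i _; rewrite !mxE.
rewrite -expr2 (le_trans (CauchySchwarz _ _))// mulrC ler_wpM2r ?dot_ge0//.
by rewrite dotE le_eqVlt; apply/orP; left; apply/eqP; apply: eq_bigr => i _; rewrite !mxE expr2.
Qed.

(** Cauchy-Schwarz gives t^2 <= k s^2 with k = [frob A], and k <= (k + 1)^2 avoids a square root.
    Any finite bound on the Rayleigh quotient will do. *)
Lemma frob_rayleigh A x : dot x (x *m A) <= (frob A + 1) * dot x x.
Proof.
have h := le_trans (CauchySchwarz x (x *m A)) (ler_wpM2l (dot_ge0 x) (frob_bound A x)).
have := dot_ge0 x; have := frob_ge0 A; move: h.
move: (dot x (x *m A)) (dot x x) (frob A) => t s k h k0 s0.
rewrite leNgt; apply/negP => lt.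
have ks : 0 <= (k + 1) * s by rewrite mulr_ge0// addr_ge0.
have : ((k + 1) * s) ^+ 2 < t ^+ 2 by rewrite ltr_sqr ?nnegrE// ltW// (le_lt_trans ks).
nra.
Qed.

Lemma dot_mulmx_outer e u : (u *m (e^T *m e)) = dot u e *: e.
Proof.
rewrite mulmxA; apply/rowP => j; rewrite mxE big_ord1 !mxE /dot mxE.
by congr (_ * _).
Qed.

End dot_product.

(** A substitute for the spectral theorem, without compactness. Let M be the least constant bounding
    the quadratic form. If M - A were invertible, the bound could be lowered strictly, so M is an
    eigenvalue; every other eigenvalue is at most M by testing the form on its eigenvector. *)
Lemma lambda_max_spec (R : realType) (n : nat) (A : 'M[R]_n) :
  (0 < n)%N -> A^T = A ->
  eigenvalue A (lambda_max A) /\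
  (forall x, dot x (x *m A) <= lambda_max A * dot x x).
Proof.
move=> n0 As.
pose C : set R := [set c | forall x, dot x (x *m A) <= c * dot x x].
have C0 : C !=set0 by exists (frob A + 1) => x; exact: frob_rayleigh.
pose o : 'rV[R]_n := const_mx 1.
have o0 : o != 0.
  apply/eqP => /rowP/(_ (Ordinal n0)); rewrite !mxE => /eqP.
  by rewrite oner_eq0.
have lbC x : x != 0 -> lbound C (dot x (x *m A) / dot x x).
  by move=> x0 c Cc; rewrite ler_pdivrMr ?dot_gt0//; exact: Cc.
have hC : has_inf C by split => //; exists (dot o (o *m A) / dot o o); exact: lbC.
set M := inf C.
have CM : C M.
  move=> x; have [->|x0] := eqVneq x 0; first by rewrite !dot0l mulr0.
  by rewrite -ler_pdivrMr ?dot_gt0//; apply: lb_le_inf => //; exact: lbC.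
pose B := M%:M - A.
have Bs : B^T = B by rewrite /B linearB /= tr_scalar_mx As.
have xB x : dot x (x *m B) = M * dot x x - dot x (x *m A).
  by rewrite /B mulmxBr mul_mx_scalar dotDr dotZr dotNr.
have Bp x : 0 <= dot x (x *m B) by rewrite xB subr_ge0; exact: CM.
have eM : eigenvalue A M.
  have [d0|d0] := eqVneq (\det B) 0.
    move/eqP/det0P : d0 => [v v0 vB]; apply/eigenvalueP; exists v => //.
    by move: vB; rewrite /B mulmxBr mul_mx_scalar => /eqP; rewrite subr_eq0 => /eqP.
  have uB : B \in unitmx by rewrite unitmxE unitfE.
  (* Chaining [h1] and [h2] below gives |x|^2 <= K (x.xB), so M - 1/K still bounds the form of [A],
     against the choice of M. The final 1 keeps K positive. *)
  set K := frob (invmx B) * (frob B + 1) + 1.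
  have K0 : 0 < K by rewrite /K; have := frob_ge0 (invmx B); have := frob_ge0 B; nra.
  suff /(ge_inf hC.2) : C (M - K^-1) by rewrite -/M lerBrDr gerDl leNgt invr_gt0 K0.
  move=> x; rewrite mulrBl lerBrDr addrC -lerBrDr -xB mulrC ler_pdivrMr//.
  set y := x *m B.
  have h1 : dot x x <= frob (invmx B) * dot y y.
    by have := frob_bound (invmx B) y; rewrite /y mulmxK.
  (* Cauchy-Schwarz for the form of [B] at x and y = xB reads |y|^4 <= (x.y)(y.yB); bound y.yB by
     [frob_rayleigh] and divide by |y|^2. *)
  have h2 : dot y y <= (frob B + 1) * dot x y.
    have := @psd_CauchySchwarz _ _ B x y Bs Bp; rewrite -[x *m B]/y.
    have -> : dot x (y *m B) = dot y y by rewrite -{1}Bs -dot_mulmxl.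
    have := frob_rayleigh B y; have := Bp x; rewrite -[x *m B]/y.
    have := dot_ge0 y; have := frob_ge0 B; have := Bp y.
    move: (dot y y) (dot x y) (dot y (y *m B)) (frob B) => p q r k.
    move=> r0 k0 p0 q0 h h'.
    have [->|pn] := eqVneq p 0; first by nra.
    have pp : 0 < p by rewrite lt_neqAle eq_sym pn.
    rewrite -(ler_pM2l pp); nra.
  have := frob_ge0 (invmx B); have := Bp x; rewrite -[x *m B]/y /K.
  move: h1 h2; move: (frob (invmx B)) (frob B) (dot x x) (dot y y) (dot x y).
  move=> k1 k2 p q r; nra.
suff -> : lambda_max A = M by [].
apply/eqP; rewrite eq_le; apply/andP; split.
  apply: ge_sup; first by exists M.
  move=> c /= /eigenvalueP[v vA v0].
  have := CM v; rewrite vA dotZr.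
  by rewrite ler_pM2r ?dot_gt0.
apply: sup_upper_bound => //; split; first by exists M.
exists M => c /= /eigenvalueP[v vA v0].
by have := CM v; rewrite vA dotZr ler_pM2r ?dot_gt0.
Qed.

Section perturbation.
Variables (R : realType) (n : nat) (W : 'M[R]_n) (e : 'rV[R]_n) (a w : R).
Hypotheses (n0 : (0 < n)%N) (Ws : W^T = W) (e1 : dot e e = 1).
Hypotheses (a0 : 0 < a) (w0 : 0 <= w) (wa : w <= a / 4).
Hypothesis Ww : forall x, dot (x *m W) (x *m W) <= w ^+ 2 * dot x x.

Let A := a *: (e^T *m e) + W.
Let b := dot e (e *m W).
Let q := dot (e *m W) (e *m W).
Let l := lambda_max A.

(* The unit vector e is the top eigenvector up to a small orthogonal correction z;
   testing the eigenvalue equation against e, eW and z gives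
   l (l - a) = a b + q + O(q w / a). *)
Lemma lambda_max_rank1_perturbation : `|b| <= a / 2 ->
  `|l - a - b - q / a| <= 4 * q * w / a ^+ 2 + (2 * `|b| + 4 * q / a) ^+ 2 / a.
Proof.
move=> ba.
have Ha := a0; have Hw := w0; have Hwa := wa.
have As : A^T = A by rewrite /A linearD linearZ /= trmx_mul trmxK Ws.
have [/eigenvalueP[v0 v0A v0n] ray] := lambda_max_spec n0 As.
have xA x : x *m A = (a * dot x e) *: e + x *m W.
  by rewrite /A mulmxDr -scalemxAr dot_mulmx_outer scalerA.
have lge : a + b <= l.
  have := ray e; rewrite xA e1 dotDr dotZr e1 !mulr1 -/l -/b.
  by [].
have lge2 : a / 2 <= l.
  by move: ba; rewrite ler_norml => /andP[ba _]; lra.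
(* An eigenvector orthogonal to e would be an eigenvector of [W] for l >= a/2, while [W] has norm at
   most w <= a/4. *)
have c0 : dot v0 e != 0.
  apply/eqP => c0; have := Ww v0.
  have -> : v0 *m W = l *: v0 by rewrite -v0A xA c0 mulr0 scale0r add0r.
  rewrite dotZl dotZr mulrA ler_pM2r ?dot_gt0// => h.
  have h1 : w * w <= (a / 4) * (a / 4) by rewrite ler_pM.
  have h2 : (a / 2) * (a / 2) <= l * l by rewrite ler_pM// ?divr_ge0// ltW.
  have h3 : 0 < a * a by rewrite mulr_gt0.
  by move: h; rewrite expr2; lra.
(* Normalizing by v.e = 1 rather than |v| = 1 makes v - e orthogonal to e. *)
have [v ve vA] : exists2 v, dot v e = 1 & l *: v = a *: e + v *m W.
  pose v := (dot v0 e)^-1 *: v0.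
  have ve : dot v e = 1 by rewrite /v dotZl mulVf.
  exists v => //; have -> : a *: e + v *m W = v *m A by rewrite xA ve mulr1.
  by rewrite /v -scalemxAl v0A !scalerA mulrC.
have [z vE] : exists z, v = e + z by exists (v - e); rewrite addrC subrK.
have ze : dot z e = 0.
  by move: ve; rewrite vE dotDl e1; lra.
have symW x y : dot (x *m W) y = dot x (y *m W) by rewrite dot_mulmxl Ws.
have i1 : l = a + dot v (e *m W).
  have := congr1 (fun x => dot x e) vA.
  by rewrite dotDl !dotZl ve e1 symW !mulr1.
pose rho := dot (z *m W) (e *m W).
have i2 : l * (l - a) = a * b + q + rho.
  have := congr1 (fun x => dot x (e *m W)) vA.
  rewrite dotDl !dotZl -/b.
  have -> : dot (v *m W) (e *m W) = q + rho by rewrite vE mulmxDl dotDl.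
  have -> : l - a = dot v (e *m W) by rewrite {1}i1; ring.
  by move=> ->; rewrite addrA.
have i3 : l * dot z z = dot (e *m W) z + dot (z *m W) z.
  have := congr1 (fun x => dot x z) vA.
  rewrite dotDl !dotZl (dotC e z) ze mulr0 add0r {2}vE mulmxDl dotDl => <-.
  by rewrite vE dotDl (dotC e z) ze add0r.
have zz0 := dot_ge0 z.
have q0 : 0 <= q := dot_ge0 _.
have lw : a / 4 <= l - w by rewrite lerBrDr (le_trans _ lge2)//; have := wa; lra.
have lw0 : 0 < l - w by rewrite (lt_le_trans _ lw)// divr_gt0.
have b1 : dot (z *m W) z <= w * dot z z.
  have h := le_trans (CauchySchwarz (z *m W) z) (ler_wpM2r zz0 (Ww z)).
  rewrite leNgt; apply/negP => h'; have : 0 <= w * dot z z by rewrite mulr_ge0.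
  by move: h h'; move: (dot (z *m W) z) (dot z z) => t s; nra.
(* From [i3] and [b1], (l - w)|z|^2 <= eW.z <= sqrt(q) |z|; squared to avoid roots. *)
have b2 : (l - w) ^+ 2 * dot z z <= q.
  have h1 : (l - w) * dot z z <= dot (e *m W) z by rewrite mulrBl i3; lra.
  have h2 := CauchySchwarz (e *m W) z; rewrite -/q in h2.
  have [zz|zn] := eqVneq (dot z z) 0; first by rewrite zz mulr0.
  have zp : 0 < dot z z by rewrite lt_neqAle eq_sym zn.
  rewrite -(ler_pM2r zp) (le_trans _ h2)//.
  have h3 : 0 <= (l - w) * dot z z by rewrite mulr_ge0// ltW.
  have -> : (l - w) ^+ 2 * dot z z * dot z z = ((l - w) * dot z z) ^+ 2 by ring.
  by rewrite ler_sqr ?nnegrE// (le_trans h3).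
(* |rho| <= w |z| sqrt(q), and [b2] bounds |z| by sqrt(q) / (l - w). *)
have b3 : `|rho| * (l - w) <= w * q.
  have h2 : rho ^+ 2 <= w ^+ 2 * dot z z * q.
    by rewrite (le_trans (CauchySchwarz _ _))// ler_wpM2r.
  rewrite -ler_sqr ?nnegrE ?mulr_ge0 ?normr_ge0 ?(ltW lw0)//.
  rewrite exprMn real_normK ?num_real//.
  have := ler_wpM2r (sqr_ge0 (l - w)) h2; move/le_trans; apply.
  rewrite exprMn.
  have -> : w ^+ 2 * dot z z * q * (l - w) ^+ 2 =
            w ^+ 2 * q * ((l - w) ^+ 2 * dot z z) by ring.
  by rewrite [q ^+ 2]expr2 [in leRHS]mulrA ler_wpM2l// mulr_ge0 ?sqr_ge0.
have b4 : `|rho| <= 4 * q * w / a.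
  rewrite ler_pdivlMr//.
  have : `|rho| * (a / 4) <= `|rho| * (l - w) by rewrite ler_wpM2l.
  lra.
have b4' : `|rho| <= q.
  apply: (le_trans b4); rewrite ler_pdivrMr//; nra.
set dl := l - a in i2 *.
(* A crude bound on l - a, from l >= a/2 and |rho| <= q. It suffices because dl enters the error
   below only through dl^2 / a. *)
have b5 : `|dl| <= 2 * `|b| + 4 * q / a.
  have l0 : 0 < l by lra.
  have -> : dl = (a * b + q + rho) / l by rewrite -i2 mulrC mulKf// gt_eqF.
  rewrite normrM normfV (gtr0_norm l0) ler_pdivrMr//.
  have h1 : `|a * b + q + rho| <= a * `|b| + 2 * q.
    rewrite (le_trans (ler_normD _ _))//.
    have := ler_normD (a * b) q; rewrite normrM (gtr0_norm a0) (ger0_norm q0); lra.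
  apply: (le_trans h1).
  have -> : a * `|b| + 2 * q = (2 * `|b| + 4 * q / a) * (a / 2) by field; exact: lt0r_neq0.
  apply: ler_wpM2l => //; apply: addr_ge0; first by rewrite mulr_ge0.
  by rewrite divr_ge0 ?mulr_ge0// ltW.
(* This is [i2] with l written as a + dl. *)
have -> : dl - b - q / a = (rho - dl ^+ 2) / a.
  apply: (mulIf (lt0r_neq0 a0)); rewrite divfK ?lt0r_neq0//.
  have : (a + dl) * dl = a * b + q + rho by rewrite -i2 /dl [a + _]addrC subrK.
  by clearbody dl rho b q; rewrite !mulrBl divfK ?lt0r_neq0//; lra.
rewrite normrM normfV (gtr0_norm a0) ler_pdivrMr//.
have -> : (4 * q * w / a ^+ 2 + (2 * `|b| + 4 * q / a) ^+ 2 / a) * a =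
  4 * q * w / a + (2 * `|b| + 4 * q / a) ^+ 2 by field; exact: lt0r_neq0.
rewrite (le_trans (ler_normB _ _))// lerD//.
rewrite normrX ler_sqr ?nnegrE//.
by rewrite (le_trans _ b5).
Qed.

End perturbation.

(** * Rational test vectors for the largest eigenvalue *)

Lemma rat_sequence (R : realType) (x : R) :
  exists u : nat -> rat, (fun k => ratr (u k)) @ \oo --> x.
Proof.
exists (fun k => (Num.floor (x * k.+1%:R))%:~R / k.+1%:R).
apply/cvgrPdist_le => e e0.
near=> k.
rewrite fmorph_div /= ratr_int ratr_nat.
have k0 : 0 < k.+1%:R :> R by rewrite ltr0n.
have -> : x - (Num.floor (x * k.+1%:R))%:~R / k.+1%:R =
  (x * k.+1%:R - (Num.floor (x * k.+1%:R))%:~R) / k.+1%:R :> R.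
  by rewrite mulrBl mulfK// gt_eqF.
have h1 := ge_floor (x * k.+1%:R).
have h2 := floorD1_gt (x * k.+1%:R).
rewrite intrD in h2.
rewrite ger0_norm; last by rewrite divr_ge0 ?subr_ge0.
rewrite ler_pdivrMr//.
apply: (@le_trans _ _ 1); first by rewrite lerBlDl ltW.
rewrite -ler_pdivrMl// mulr1.
rewrite (@le_trans _ _ k%:R) ?ler_nat//.
near: k; exact: nbhs_infty_ger.
Unshelve. all: by end_near. Qed.

(** By density and continuity of the form, rational vectors decide the inequality. This turns an
    event about [lambda_max] into a countable intersection. *)
Lemma lambda_max_leP (R : realType) (n : nat) (A : 'M[R]_n) (c : R) :
  (0 < n)%N -> A^T = A ->
  lambda_max A <= c <->
  forall x : 'rV[rat]_n, dot (map_mx ratr x) (map_mx ratr x *m A) <=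
                         c * dot (map_mx ratr x) (map_mx ratr x).
Proof.
move=> n0 As; have [/eigenvalueP[v vA v0] ray] := lambda_max_spec n0 As; split.
  by move=> lc x; apply: (le_trans (ray _)); rewrite ler_wpM2r ?dot_ge0.
move=> h.
have {}h (x : 'rV[R]_n) : dot x (x *m A) <= c * dot x x.
  have /choice[u uE] : forall i, exists u : nat -> rat, (fun k => ratr (u k)) @ \oo --> x 0 i.
    by move=> i; exact: rat_sequence.
  pose y k : 'rV[rat]_n := \row_i u i k.
  have yE k i : (map_mx ratr (y k)) 0 i = ratr (u i k) :> R by rewrite !mxE.
  have cy i : (fun k => (map_mx ratr (y k) : 'rV[R]_n) 0 i) @ \oo --> x 0 i.
    by under eq_fun do rewrite yE; exact: uE.
  have dA z : dot z (z *m A) = \sum_i z 0 i * \sum_j z 0 j * A j i.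
    by rewrite dotE; apply: eq_bigr => i _; rewrite mxE.
  have c1 : (fun k => dot (map_mx ratr (y k)) (map_mx ratr (y k))) @ \oo --> dot x x.
    rewrite dotE; under eq_fun => k do rewrite dotE.
    by apply: (cvg_big add_continuous) => i _; apply: cvgM; exact: cy.
  have c2 : (fun k => dot (map_mx ratr (y k)) (map_mx ratr (y k) *m A)) @ \oo -->
            dot x (x *m A).
    rewrite dA; under eq_fun => k do rewrite dA.
    apply: (cvg_big add_continuous) => i _; apply: cvgM; first exact: cy.
    by apply: (cvg_big add_continuous) => j _; apply: cvgM; [exact: cy|exact: cvg_cst].
  apply: (ler_cvg_to c2 (cvgM (cvg_cst c) c1)).
  by apply: nearW => k; exact: h.
by have := h v; rewrite vA dotZr ler_pM2r ?dot_gt0.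
Qed.

(** * Moments and distribution function of the normal law *)

Section normal_moments.
Variable R : realType.
Local Notation mu := (@lebesgue_measure R).

(** With x = y^2 / c, the exponential series gives x^(k+1) <= (k+1)! exp x, while |y|^k <= 1 +
    (y^2)^(k+1) = 1 + (c x)^(k+1). Their combination is the constant chosen. *)
Lemma power_gauss_bounded (c : R) (k : nat) : 0 < c ->
  exists2 C, 0 <= C & forall y, `|y| ^+ k * expR (- (y ^+ 2 / c)) <= C.
Proof.
move=> c0; exists (1 + c ^+ k.+1 * (k.+1)`!%:R).
  by rewrite addr_ge0// mulr_ge0// exprn_ge0// ltW.
move=> y; rewrite expRN ler_pdivrMr ?expR_gt0//.
set x := y ^+ 2 / c.
have x0 : 0 <= x by rewrite divr_ge0 ?sqr_ge0// ltW.
have h1 : 1 <= expR x by rewrite -expR0 ler_expR.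
have h2 : x ^+ k.+1 <= (k.+1)`!%:R * expR x.
  rewrite mulrC -ler_pdivrMr ?ltr0n ?fact_gt0//.
  by rewrite (le_trans _ (expR_ge1Dxn k x0))// lerDr.
rewrite mulrDl mul1r -mulrA.
have h3 : `|y| ^+ k <= 1 + (y ^+ 2) ^+ k.+1.
  rewrite -real_normK ?num_real// -exprM.
  have [y1|y1] := leP `|y| 1.
    by rewrite (@le_trans _ _ 1) ?exprn_ile1// lerDl exprn_ge0.
  rewrite (@le_trans _ _ (`|y| ^+ (2 * k.+1)))//; last by rewrite lerDr.
  by rewrite ler_eXn2l// mul2n -addnn (leq_trans (leqnSn k))// leq_addr.
rewrite (le_trans h3)// lerD// (_ : y ^+ 2 = c * x); last first.
  by rewrite /x mulrC divfK// gt_eqF.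
by rewrite exprMn ler_wpM2l// exprn_ge0// ltW.
Qed.


Variables (m s : R).
Hypothesis s0 : s != 0.

(** The integrand of the central moment of order k. *)
Definition normal_monom (k : nat) (x : R) : R := (x - m) ^+ k * normal_pdf m s x.

Lemma measurable_normal_monom k : measurable_fun setT (normal_monom k).
Proof.
apply: measurable_funM; last exact: measurable_normal_pdf.
by apply: measurable_funX; apply: measurable_funB.
Qed.

Lemma normal_pdf_neq0 (s' x : R) : s' != 0 ->
  normal_pdf m s' x = normal_peak s' * expR (- ((x - m) ^+ 2 / (s' ^+ 2 *+ 2))).
Proof. by move=> s'0; rewrite normal_pdfE// /normal_fun mulNr. Qed.

Lemma normal_monom_bounded k :
  exists2 C, 0 <= C & forall x, `|normal_monom k x| <= C.
Proof.
have c0 : 0 < s ^+ 2 *+ 2 by rewrite pmulrn_lgt0// exprn_even_gt0.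
have [C C0 hC] := power_gauss_bounded k c0.
exists (normal_peak s * C); first by rewrite mulr_ge0// normal_peak_ge0.
move=> x; rewrite /normal_monom normal_pdf_neq0// normrM normrX.
rewrite [`|_ * expR _|]ger0_norm ?mulr_ge0 ?normal_peak_ge0 ?expR_ge0//.
by rewrite mulrCA ler_wpM2l ?normal_peak_ge0.
Qed.

Lemma integrable_normal_monom k : mu.-integrable setT (EFin \o normal_monom k).
Proof.
have c0 : 0 < s ^+ 2 *+ 4 by rewrite pmulrn_lgt0// exprn_even_gt0.
have [C C0 hC] := power_gauss_bounded k c0.
(* The Gaussian factor is a product of two equal exponentials: one absorbs the power, the other is,
   up to a constant, the density with deviation sqrt 2 times s, which is integrable. *)
pose s' := Num.sqrt 2 * s.
have s'0 : s' != 0 by rewrite mulf_neq0// sqrtr_eq0 -ltNge.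
have p0 := normal_peak_gt0 s'0.
pose K := normal_peak s * C / normal_peak s'.
have K0 : 0 <= K by rewrite divr_ge0 ?mulr_ge0 ?normal_peak_ge0.
apply: (@le_integrable _ _ _ mu setT measurableT _ (fun x => K%:E * (normal_pdf m s' x)%:E)%E).
- by apply/measurable_EFinP; exact: measurable_normal_monom.
- move=> x _; rewrite /= lee_fin.
  rewrite [leRHS]ger0_norm; last by rewrite mulr_ge0 ?normal_pdf_ge0.
  rewrite /normal_monom !normal_pdf_neq0// normrM normrX.
  rewrite [`|_ * expR _|]ger0_norm ?mulr_ge0 ?normal_peak_ge0 ?expR_ge0//.
  rewrite /K [leRHS]mulrA divfK ?gt_eqF//.
  have -> : s' ^+ 2 *+ 2 = s ^+ 2 *+ 4.
    by rewrite /s' exprMn sqr_sqrtr// mulr_natl -mulrnA.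
  have -> : expR (- ((x - m) ^+ 2 / (s ^+ 2 *+ 2))) =
      expR (- ((x - m) ^+ 2 / (s ^+ 2 *+ 4))) * expR (- ((x - m) ^+ 2 / (s ^+ 2 *+ 4))).
    rewrite -expRD; congr expR.
    rewrite -!(mulr_natr (s ^+ 2)); field; exact: s0.
  rewrite mulrCA -[leRHS]mulrA ler_wpM2l ?normal_peak_ge0//.
  by rewrite mulrA ler_wpM2r ?expR_ge0.
- exact: (integrableZl measurableT K (integrable_normal_pdf m s')).
Qed.

(** At [k = 0] the truncated predecessor is harmless, its coefficient being zero. *)
Lemma derive_normal_monom k (x : R) :
  is_derive x (1 : R) (normal_monom k)
    (k%:R * normal_monom k.-1 x - s ^- 2 * normal_monom k.+1 x).
Proof.
have -> : normal_monom k = ((fun x => x - m) ^+ k) *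
    (normal_peak s *: (expR \o (- (s ^+ 2 *+ 2)^-1 *: ((fun x : R => x - m) ^+ 2)))).
  apply/funext => y; rewrite /normal_monom normal_pdf_neq0//.
  rewrite fctE /= /GRing.scale /= !fctE /= /GRing.scale /=.
  by rewrite mulNr [in RHS](mulrC (s ^+ 2 *+ 2)^-1).
have dB : is_derive x 1 (fun x : R => x - m) 1.
  by rewrite -[1 in X in is_derive _ _ _ X]subr0; apply: is_deriveB.
have dX k' : is_derive x 1 ((fun x => x - m) ^+ k') (k'%:R * (x - m) ^+ k'.-1).
  by apply: is_derive_eq; rewrite /GRing.scale /= mulr1.
have dE : is_derive x 1 (expR \o (- (s ^+ 2 *+ 2)^-1 *: ((fun x : R => x - m) ^+ 2)))
   (expR (- ((x - m) ^+ 2 / (s ^+ 2 *+ 2))) * (- (s ^+ 2 *+ 2)^-1 * (2 * (x - m)))).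
  apply: is_derive1_comp.
    have -> : - ((x - m) ^+ 2 / (s ^+ 2 *+ 2)) =
              (- (s ^+ 2 *+ 2)^-1 *: ((fun x : R => x - m) ^+ 2)) x.
      by transitivity (- (s ^+ 2 *+ 2)^-1 * (x - m) ^+ 2) => //; rewrite mulNr mulrC.
    exact: is_derive_expR.
apply: is_derive_eq.
rewrite !fctE /GRing.scale /=.
have -> : expR (- (s ^+ 2 *+ 2)^-1 * (x - m) ^+ 2) = expR (- ((x - m) ^+ 2 / (s ^+ 2 *+ 2))).
  by rewrite mulNr mulrC.
rewrite /normal_monom !normal_pdf_neq0// (exprS _ k).
move: (expR (- ((x - m) ^+ 2 / (s ^+ 2 *+ 2)))) (normal_peak s) => e p.
move: ((x - m) ^+ k) ((x - m) ^+ k.-1) (x - m) => u v y.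
rewrite -mulr_natr; field; exact: s0.
Qed.

Lemma continuous_normal_monom k : continuous (normal_monom k).
Proof.
move=> x; apply/differentiable_continuous/derivable1_diffP.
by have [] := derive_normal_monom k x.
Qed.

(** Dominated convergence, linking the whole line to the compact intervals on which the fundamental
    theorem of calculus is applied. *)
Lemma integral_exhaustion (h : R -> R) (c : R) : mu.-integrable setT (EFin \o h) ->
  (fun n : nat => (\int[mu]_(x in `[(c - n%:R)%R, (c + n%:R)%R]) (h x)%:E)%E) @ \oo -->
  (\int[mu]_x (h x)%:E)%E.
Proof.
move=> ih.
pose f n := (EFin \o h) \_ `[(c - n%:R), (c + n%:R)].
have mh := measurable_int _ ih.
have [] := @dominated_convergence _ _ _ mu setT measurableT f (EFin \o h) (abse \o (EFin \o h)).
- move=> n; rewrite /f; apply/(measurable_restrictT (EFin \o h) (measurable_itv _)).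
  exact: measurable_funTS.
- exact: mh.
- apply: aeW => x _.
  apply: cvg_near_cst; near=> n; rewrite /f patchE mem_set//= in_itv/=.
  have : `|x - c| <= n%:R by near: n; exact: nbhs_infty_ger.
  by rewrite ler_norml; lra.
- exact: integrable_abse.
- apply: aeW => x n _; rewrite /f patchE; case: ifP => //= _.
  by rewrite normr0 lee_fin.
move=> _ _ H; under eq_fun do rewrite integral_mkcond.
exact: H.
Unshelve. all: by end_near. Qed.

(** Integration by parts: the derivative of [normal_monom k] has integral zero because the boundary
    terms vanish at infinity. *)
Lemma normal_moment_rec k :
  \int[mu]_x normal_monom k.+1 x = s ^+ 2 * k%:R * \int[mu]_x normal_monom k.-1 x.
Proof.
pose h x := k%:R * normal_monom k.-1 x - s ^- 2 * normal_monom k.+1 x.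
have i1 : mu.-integrable setT (EFin \o (fun x => k%:R * normal_monom k.-1 x)).
  exact: (integrableZl measurableT _ (integrable_normal_monom _)).
have i2 : mu.-integrable setT (EFin \o (fun x => s ^- 2 * normal_monom k.+1 x)).
  exact: (integrableZl measurableT _ (integrable_normal_monom _)).
have ih : mu.-integrable setT (EFin \o h) by exact: (integrableB measurableT i1 i2).
have ftc n : (\int[mu]_(x in `[(m - n.+1%:R)%R, (m + n.+1%:R)%R]) (h x)%:E =
    (normal_monom k (m + n.+1%:R))%:E - (normal_monom k (m - n.+1%:R))%:E)%E.
  apply: continuous_FTC2.
  - by rewrite ltrD2l gtrN.
  - apply: continuous_subspaceT => x.
    by apply: cvgB; (apply: cvgM; [exact: cvg_cst|exact: continuous_normal_monom]).
  - split.
    + by move=> x _; have [] := derive_normal_monom k x.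
    + by apply: cvg_at_right_filter; exact: continuous_normal_monom.
    + by apply: cvg_at_left_filter; exact: continuous_normal_monom.
  - by move=> x _; rewrite derive1E; have [_ ->] := derive_normal_monom k x.
(* The monomial of degree k + 1 is bounded, so the one of degree k is O(1/n) at distance n + 1 from
   m. Taking e = 1 and e = -1 covers both ends. *)
have F0 (e : R) : `|e| = 1 -> (fun n => normal_monom k (m + e * n.+1%:R)) @ \oo --> 0.
  move=> e1.
  have [C C0 hC] := normal_monom_bounded k.+1.
  apply/cvgrPdist_le => eps eps0; near=> n.
  rewrite sub0r normrN.
  have := hC (m + e * n.+1%:R); rewrite /normal_monom exprS -mulrA normrM.
  rewrite [X in `|X| * _]addrAC subrr add0r normrM e1 mul1r normr_nat mulrC.
  rewrite -ler_pdivlMr ?ltr0n// => /le_trans; apply.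
  rewrite ler_pdivrMr ?ltr0n// -ler_pdivrMl//.
  rewrite (@le_trans _ _ n%:R) ?ler_nat//.
  by near: n; exact: nbhs_infty_ger.
have h0 : (\int[mu]_x (h x)%:E = 0)%E.
  have := integral_exhaustion m ih.
  rewrite -(cvg_shiftn 1).
  under eq_fun do rewrite addn1 ftc.
  move/cvg_unique; apply => //.
  rewrite /= -[0%E]/(0%:E) -[X in _ --> X%:E](subr0 0).
  under eq_fun do rewrite -EFinB.
  apply: cvg_EFin; first by near=> n.
  apply: cvgB; first by have := F0 1 (normr1 _); under eq_fun do rewrite mul1r.
  have := F0 (-1); rewrite normrN1 => /(_ erefl).
  by under eq_fun do rewrite mulN1r.
have := congr1 fine h0; rewrite -/(Rintegral _ _ _) RintegralB// !RintegralZl//; last 2 first.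
- exact: integrable_normal_monom.
- exact: integrable_normal_monom.
move=> /= /eqP; rewrite subr_eq0 => /eqP E.
rewrite -mulrA E mulrA divff ?mul1r// sqrf_eq0.
Unshelve. all: by end_near. Qed.


End normal_moments.

(** * Integrals against normal and possibly degenerate Gaussian laws *)

Section normal_prob_density.
Variables (R : realType) (m s : R).
Local Notation mu := (@lebesgue_measure R).

(** Both functions have the same integral, the normal probability, over every measurable set. *)
Let density : ae_eq mu setT
  (Radon_Nikodym_SigmaFinite.f (normal_prob m s) mu) (EFin \o normal_pdf m s).
Proof.
apply: integral_ae_eq => //.
- exact: (Radon_Nikodym_SigmaFinite.f_integrable (normal_prob_dominates m s)).
- by apply/measurable_EFinP; exact: measurable_normal_pdf.
- by move=> E _ mE; rewrite -(Radon_Nikodym_SigmaFinite.f_integral (normal_prob_dominates m s)).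
Qed.

Lemma ge0_integral_normal_prob (f : R -> \bar R) :
  measurable_fun setT f -> (forall x, 0 <= f x)%E ->
  (\int[normal_prob m s]_x f x = \int[mu]_x (f x * (normal_pdf m s x)%:E))%E.
Proof.
move=> mf f0.
rewrite -(Radon_Nikodym_SigmaFinite.change_of_variables (normal_prob_dominates m s))//.
apply: ae_eq_integral => //.
- apply: emeasurable_funM => //; apply: (measurable_int mu).
  exact: (Radon_Nikodym_SigmaFinite.f_integrable (normal_prob_dominates m s)).
- apply: emeasurable_funM => //; apply/measurable_EFinP; exact: measurable_normal_pdf.
- exact: ae_eqe_mul2l.
Qed.

Lemma integral_normal_prob (f : R -> \bar R) :
  (normal_prob m s).-integrable setT f ->
  (\int[normal_prob m s]_x f x = \int[mu]_x (f x * (normal_pdf m s x)%:E))%E.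
Proof.
move=> f1; have mf := measurable_int _ f1.
rewrite -(Radon_Nikodym_change_of_variables (normal_prob_dominates m s))//.
apply: ae_eq_integral => //.
- apply: emeasurable_funM => //; apply: (measurable_int mu).
  by apply: Radon_Nikodym_integrable; exact: normal_prob_dominates.
- apply: emeasurable_funM => //; apply/measurable_EFinP; exact: measurable_normal_pdf.
- apply: ae_eqe_mul2l; apply: ae_eq_trans density; apply: ae_eq_sym.
  by apply: ae_eq_Radon_Nikodym_SigmaFinite => //; exact: normal_prob_dominates.
Qed.

End normal_prob_density.

Section gaussian_moments.
Context {d : measure_display} {T : measurableType d} {R : realType}.
Variable (P : probability T R).
Local Notation mu := (@lebesgue_measure R).

Variables (X : T -> R) (m s : R).
Hypothesis mX : measurable_fun setT X.
Hypothesis lawX : forall A : set R, measurable A ->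
    P (X @^-1` A) = if s == 0 then \d_m A else normal_prob m s A.

Let GR : measurableType _ := measurableTypeR R.
Let mX' : measurable_fun setT (X : T -> GR) := mX.
Let X' : {mfun T >-> GR} := @mfun_Sub _ _ T GR X (mem_set mX').

Let gaussian_law_integral (f : GR -> \bar R) : measurable_fun setT f ->
  (\int[distribution P X']_x f x =
   if (s == 0)%R then f m else \int[normal_prob m s]_x f x)%E.
Proof.
move=> mf; case: ifPn => s0.
  rewrite (@eq_measure_integral _ GR _ _ (\d_(m : GR))); last first.
    by move=> A mA _; have := lawX mA; rewrite s0.
  by rewrite integral_dirac// diracT mul1e.
apply: eq_measure_integral => A mA _.
by have := lawX mA; rewrite (negbTE s0).
Qed.

Lemma gaussian_central_integrable k :
  P.-integrable setT (EFin \o (fun w => (X w - m) ^+ k)).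
Proof.
have mf : measurable_fun setT (fun x : R => (x - m) ^+ k).
  by apply: measurable_funX; apply: measurable_funB.
apply/integrableP; split.
  by apply/measurable_EFinP; apply: (measurableT_comp mf mX).
pose f x : \bar R := `|(x - m) ^+ k|%:E.
have mf' : measurable_fun setT f.
  by apply/measurable_EFinP; apply: measurableT_comp mf.
rewrite (_ : (\int[P]_x _)%E = \int[distribution P X']_x f x)%E; last first.
  by rewrite ge0_integral_distribution// => x; rewrite lee_fin.
rewrite gaussian_law_integral//; case: ifPn => s0; first by rewrite ltry.
rewrite ge0_integral_normal_prob//; last by move=> x; rewrite lee_fin.
have /integrableP[_] := integrable_normal_monom m s0 k.
congr (_ < _)%E; apply: eq_integral => x _ /=.
by rewrite /normal_monom normrM EFinM (ger0_norm (normal_pdf_ge0 _ _ _)).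
Qed.

(** Covers point masses too, where both sides are zero. The instances k = 0, 1 and 3 give the mean,
    the variance and the fourth moment. *)
Lemma gaussian_moment_rec k :
  \int[P]_w ((X w - m) ^+ k.+1) =
  s ^+ 2 * k%:R * \int[P]_w ((X w - m) ^+ k.-1).
Proof.
have tr j : \int[P]_w ((X w - m) ^+ j) =
    if s == 0 then 0 ^+ j else \int[mu]_x normal_monom m s j x.
  have mf : measurable_fun setT (fun x : GR => ((x - m) ^+ j)%:E).
    by apply/measurable_EFinP; apply: measurable_funX; apply: measurable_funB.
  have E := esym (@integral_distribution _ _ _ _ _ P X' _ mf (gaussian_central_integrable j)).
  rewrite /Rintegral [X in fine X]E gaussian_law_integral//.
  case: ifPn => s0; first by rewrite subrr.
  rewrite integral_normal_prob//.
  apply/integrableP; split => //.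
  have maf := measurableT_comp (@abse_measurable R setT) mf.
  have := gaussian_law_integral maf.
  rewrite (negbTE s0) => <-.
  rewrite ge0_integral_distribution//; last by move=> y; exact: abse_ge0.
  by have /integrableP[] := gaussian_central_integrable j.
rewrite !tr; have [->|s0] := eqVneq s 0.
  by rewrite !expr0n /= mul0r mul0r.
exact: normal_moment_rec.
Qed.

End gaussian_moments.

(** * Distribution function of the normal law *)

Section normal_cdf.
Variable R : realType.
Local Notation mu := (@lebesgue_measure R).

Definition std_cdf (t : R) : R := fine (normal_prob 0 1 `]-oo, t]).

(** The density is bounded by its peak, so the mass of an interval is at most peak times length. *)
Lemma std_cdf_lipschitz (u t : R) : u <= t ->
  0 <= std_cdf t - std_cdf u <= normal_peak 1 * (t - u).
Proof.
move=> ut.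
have mI (v : R) : measurable `]-oo, v] by exact: measurable_itv.
have E : normal_prob 0 1 `]-oo, t] = (normal_prob 0 1 `]-oo, u] + normal_prob 0 1 `]u, t])%E.
  rewrite -measureU//; last first.
  - apply/seteqP; split => // x [] /=; rewrite !in_itv /= => h1 /andP[h2 _].
    by move: (le_lt_trans h1 h2); rewrite ltxx.
  - congr (normal_prob 0 1 _); apply/seteqP; split => x /=; rewrite !in_itv /=.
      by case: (leP x u) => ? ?; [left|right].
    by case => [/le_trans|/andP[]//]; apply.
have fu := fin_num_measure (normal_prob 0 1) _ (mI u).
have fi := fin_num_measure (normal_prob 0 1) _ (measurable_itv `]u, t]).
rewrite /std_cdf E fineD// addrAC subrr add0r fine_ge0 ?measure_ge0//=.
rewrite -lee_fin fineK// /normal_prob.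
apply: (@le_trans _ _ (\int[mu]_(x in `]u, t]) (normal_peak 1)%:E)%E).
  apply: ge0_le_integral => //=.
  - by move=> x _; rewrite lee_fin normal_pdf_ge0.
  - by apply/measurable_EFinP; apply: measurable_funTS; exact: measurable_normal_pdf.
  - by move=> x _; rewrite lee_fin normal_pdf_ub// oner_neq0.
by rewrite integral_cst//= lebesgue_measure_itv/= lte_fin; case: ltP => h;
  rewrite ?mule0 ?lee_fin ?mulr_ge0 ?normal_peak_ge0 ?subr_ge0.
Qed.

Lemma std_cdf_continuous : continuous std_cdf.
Proof.
move=> t; apply/cvgrPdist_le => e e0.
have p0 : 0 < normal_peak 1 :> R by rewrite normal_peak_gt0// oner_neq0.
near=> u.
have H : `|t - u| <= e / normal_peak 1.
  by near: u; apply: cvgr_dist_le; [exact: cvg_id|rewrite divr_gt0].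
move: H; rewrite ler_pdivlMr// mulrC => /(le_trans _); apply.
case: (leP u t) => ut.
  have /andP[h1 h2] := std_cdf_lipschitz ut.
  by rewrite ger0_norm// [`|t - u|]ger0_norm ?subr_ge0.
have /andP[h1 h2] := std_cdf_lipschitz (ltW ut).
by rewrite distrC ger0_norm// distrC [`|u - t|]ger0_norm ?subr_ge0// ltW.
Unshelve. all: by end_near. Qed.

(** Substitution y -> (y - m) / |s|. The absolute value is there because [s] may be negative: the
    law depends on s only through s^2. *)
Lemma normal_prob_cdf (m s x : R) : s != 0 ->
  fine (normal_prob m s `]-oo, x]) = std_cdf ((x - m) / `|s|).
Proof.
move=> s0; have s1 : 0 < `|s| by rewrite normr_gt0.
pose F y := (y - m) / `|s|.
have dF (y : R) : is_derive y (1 : R) F `|s|^-1.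
  have -> : F = `|s|^-1 *: ((fun y : R => y - m)).
    by apply/funext => z; rewrite /F mulrC.
  have dB : is_derive y (1 : R) (fun x : R => x - m) 1.
    by rewrite -[1 in X in is_derive _ _ _ X]subr0; apply: is_deriveB.
  by apply: is_derive_eq; rewrite /GRing.scale /= mulr1.
have dFE : F^`()%classic = cst `|s|^-1.
  by apply/funext => y; rewrite derive1E; have [_ ->] := dF y.
have cF : continuous F.
  move=> y; apply/differentiable_continuous/derivable1_diffP.
  by have [] := dF y.
rewrite /std_cdf /normal_prob -/(F x); congr fine.
rewrite (@increasing_ge0_integration_by_substitutionNy _ F (normal_pdf 0 1)).
- apply: eq_integral => y _; rewrite dFE /= !fctE /=; congr EFin.
  rewrite !normal_pdfE ?oner_neq0// /normal_fun /normal_peak /F subr0.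
  have -> : - ((y - m) / `|s|) ^+ 2 / (1 ^+ 2 *+ 2) = - (y - m) ^+ 2 / (s ^+ 2 *+ 2).
    by rewrite expr_div_n real_normK ?num_real// expr1n !mulNr -mulrA -invfM mulr_natr.
  by rewrite expr1n mul1r -mulrnAr sqrtrM ?sqr_ge0// sqrtr_sqr invfM -mulrA mulrC.
- by move=> y z _ _ yz; rewrite /F ltr_pM2r ?invr_gt0// ltrD2r.
- by move=> y _; rewrite dFE; exact: cst_continuous.
- by rewrite dFE; exact: is_cvg_cst.
- by rewrite dFE; exact: cvg_cst.
- split; first by move=> y _; have [] := dF y.
  by apply: cvg_at_left_filter; exact: cF.
- apply/cvgrNyPle => M; near=> y; rewrite /F ler_pdivrMr// lerBlDr.
  by near: y; by apply: nbhs_ninfty_le; rewrite num_real.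
- by apply: continuous_subspaceT; exact: continuous_normal_pdf (oner_neq0 _).
- by move=> y _; exact: normal_pdf_ge0.
Unshelve. all: by end_near. Qed.
End normal_cdf.

(** * Random variables with all moments, Isserlis' formula *)

Section level_sets.
Context {d : measure_display} {T : measurableType d} {R : realType}.

Lemma measurable_sublevel (X : T -> R) (x : R) : measurable_fun setT X ->
  measurable [set w | X w <= x].
Proof.
move=> mX; have := mX measurableT _ (measurable_itv `]-oo, x]); rewrite setTI.
by congr (measurable _); apply/seteqP; split => w /=; rewrite in_itv.
Qed.

Lemma measurable_superlevel (X : T -> R) (x : R) : measurable_fun setT X ->
  measurable [set w | x <= X w].
Proof.
move=> mX; have := mX measurableT _ (measurable_itv `[x, +oo[); rewrite setTI.
by congr (measurable _); apply/seteqP; split => w /=; rewrite in_itv /= andbT.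
Qed.

End level_sets.

Section all_moments.
Context {d : measure_display} {T : measurableType d} {R : realType}.
Variable P : probability T R.
Implicit Types (X Y : T -> R) (c : R).

(** These variables form an algebra, so integrability of any polynomial in the entries follows from
    that of the entries. *)
Definition all_moments X := forall k, P.-integrable setT (EFin \o (fun w => X w ^+ k)).

Definition mean X : R := \int[P]_w X w.
Local Notation Ex := mean.

Lemma all_moments_integrable X : all_moments X -> P.-integrable setT (EFin \o X).
Proof. by move=> /(_ 1%N). Qed.

Lemma all_moments_measurable X : all_moments X -> measurable_fun setT X.
Proof. by move=> /all_moments_integrable /measurable_int /measurable_EFinP. Qed.

Lemma all_moments_le X (Y : nat -> T -> R) : measurable_fun setT X ->
  (forall k, P.-integrable setT (EFin \o Y k)) ->
  (forall k w, `|X w| ^+ k <= Y k w) -> all_moments X.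
Proof.
move=> mX iY XY k; apply: (le_integrable measurableT _ _ (iY k)).
  by apply/measurable_EFinP; exact: measurable_funX.
move=> w _ /=; rewrite lee_fin normrX (le_trans (XY k w))//.
exact: ler_norm.
Qed.

Lemma all_moments_cst c : all_moments (cst c).
Proof.
by move=> k; exact: (finite_measure_integrable_cst P (c ^+ k)).
Qed.

Lemma all_moments_mul X Y : all_moments X -> all_moments Y ->
  all_moments (fun w => X w * Y w).
Proof.
move=> aX aY.
(* |XY|^k <= X^(2k) + Y^(2k); the even exponents make the majorant integrable without absolute
   values. *)
apply: (@all_moments_le _ (fun k w => X w ^+ (2 * k) + Y w ^+ (2 * k))).
- by apply: measurable_funM; exact: all_moments_measurable.
- by move=> k; exact: (integrableD measurableT (aX _) (aY _)).
- move=> k w; rewrite normrM exprMn !exprM -(@real_normK _ (X w)) ?num_real//.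
  rewrite -(@real_normK _ (Y w)) ?num_real// -!exprM ![(2 * k)%N]mulnC !exprM.
  move: (`|X w| ^+ k) (`|Y w| ^+ k) => x y; have := sqr_ge0 (x - y); nra.
Qed.

Lemma all_moments_add X Y : all_moments X -> all_moments Y ->
  all_moments (fun w => X w + Y w).
Proof.
move=> aX aY.
have iA Z k : all_moments Z -> P.-integrable setT (EFin \o (fun w => `|Z w| ^+ k)).
  move=> aZ; have := integrable_abse (aZ k).
  by apply: eq_integrable => // w _ /=; rewrite normrX.
apply: (@all_moments_le _ (fun k w => 2 ^+ k * (`|X w| ^+ k + `|Y w| ^+ k))).
- by apply: measurable_funD; exact: all_moments_measurable.
- move=> k; apply: (integrableZl measurableT (2 ^+ k)
    (integrableD measurableT (iA X k aX) (iA Y k aY))).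
- move=> k w; rewrite (@le_trans _ _ ((`|X w| + `|Y w|) ^+ k))//.
    by rewrite lerXn2r ?nnegrE ?addr_ge0// ler_normD.
  move: (normr_ge0 (X w)) (normr_ge0 (Y w)); move: `|X w| `|Y w| => x y.
  (* By symmetry y is the larger, so x + y <= 2y. *)
  wlog xy : x y / x <= y.
    move=> h x0 y0; case: (leP x y) => [|/ltW] ?; first exact: h.
    by rewrite addrC [X in _ * X]addrC; exact: h.
  move=> x0 y0; rewrite (@le_trans _ _ ((2 * y) ^+ k))//.
    by rewrite lerXn2r ?nnegrE ?addr_ge0 ?mulr_ge0//; lra.
  by rewrite exprMn ler_wpM2l ?exprn_ge0// lerDr exprn_ge0.
Qed.

Lemma all_moments_scale c X : all_moments X -> all_moments (fun w => c * X w).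
Proof. exact: all_moments_mul (all_moments_cst c). Qed.

Lemma all_moments_sum (I : Type) (r : seq I) (F : I -> T -> R) :
  (forall i, all_moments (F i)) -> all_moments (fun w => \sum_(i <- r) F i w).
Proof.
move=> aF; elim: r => [|i r IH].
  by under eq_fun do rewrite big_nil; exact: all_moments_cst.
by under eq_fun do rewrite big_cons; exact: all_moments_add.
Qed.

Lemma all_moments_exp X n : all_moments X -> all_moments (fun w => X w ^+ n).
Proof.
move=> aX; elim: n => [|n IH]; first exact: all_moments_cst.
by under eq_fun do rewrite exprS; exact: all_moments_mul.
Qed.

Lemma Ex_cst c : Ex (cst c) = c.
Proof.
have -> : Ex (cst c) = c * fine (P setT) by exact: Rintegral_cst.
by rewrite probability_setT mulr1.
Qed.

Lemma ExD X Y : all_moments X -> all_moments Y ->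
  Ex (fun w => X w + Y w) = Ex X + Ex Y.
Proof. by move=> aX aY; apply: RintegralD => //; exact: all_moments_integrable. Qed.

Lemma ExZ c X : all_moments X -> Ex (fun w => c * X w) = c * Ex X.
Proof. by move=> aX; apply: RintegralZl => //; exact: all_moments_integrable. Qed.

Lemma Ex_sum (I : Type) (r : seq I) (F : I -> T -> R) :
  (forall i, all_moments (F i)) ->
  Ex (fun w => \sum_(i <- r) F i w) = \sum_(i <- r) Ex (F i).
Proof.
move=> aF; elim: r => [|i r IH].
  by under eq_fun do rewrite big_nil; rewrite big_nil; exact: Ex_cst.
under eq_fun do rewrite big_cons; rewrite big_cons -IH.
by apply: ExD => //; exact: all_moments_sum.
Qed.

(** Expanding a polynomial in several variables becomes one application to an explicit list of
    weighted monomials. *)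
Lemma Ex_lincomb (l : seq (R * (T -> R))) :
  (forall p, List.In p l -> all_moments p.2) ->
  Ex (fun w => \sum_(p <- l) p.1 * p.2 w) = \sum_(p <- l) p.1 * Ex p.2.
Proof.
elim: l => [|p l IH] al.
  by under eq_fun do rewrite big_nil; rewrite big_nil; exact: Ex_cst.
have ap : all_moments p.2 by apply: al; left.
have {}al q : List.In q l -> all_moments q.2 by move=> ql; apply: al; right.
under eq_fun do rewrite big_cons; rewrite big_cons -IH// -ExZ//.
apply: ExD; first exact: all_moments_scale.
elim: l al {IH} => [|q l IH] al.
  by under eq_fun do rewrite big_nil; exact: all_moments_cst.
under eq_fun do rewrite big_cons; apply: all_moments_add.
  by apply: all_moments_scale; apply: al; left.
by apply: IH => r rl; apply: al; right.
Qed.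

Lemma Ex_ge0 X : (forall w, 0 <= X w) -> 0 <= Ex X.
Proof. by move=> X0; apply: Rintegral_ge0. Qed.

Lemma Ex_markov X c : all_moments X -> (forall w, 0 <= X w) -> 0 < c ->
  fine (P [set w | c <= X w]) <= Ex X / c.
Proof.
move=> aX X0 c0.
have mX := all_moments_measurable aX.
pose A := [set w | c <= X w].
have mA : measurable A by exact: measurable_superlevel.
rewrite ler_pdivlMr//.
have fP : P A \is a fin_num by exact: fin_num_measure.
have i1 : P.-integrable setT (EFin \o X) by exact: all_moments_integrable.
rewrite -lee_fin EFinM fineK// /mean /Rintegral fineK; last exact: integrable_fin_num.
have -> : (P A * c%:E = \int[P]_(w in A) c%:E)%E by rewrite integral_cst// muleC.
rewrite [leLHS]integral_mkcond; apply: ge0_le_integral => //.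
- by move=> w _; rewrite patchE; case: ifP => // _; rewrite lee_fin ltW.
- by apply/(measurable_restrictT _ mA); exact: measurable_cst.
- exact: measurable_int i1.
- move=> w _; rewrite patchE; case: ifPn; first by rewrite inE /= lee_fin.
  by move=> _; rewrite lee_fin.
Qed.

End all_moments.

Section isserlis.
Context {d : measure_display} {T : measurableType d} {R : realType}.
Variable P : probability T R.
Local Notation Ex := (mean P).

(** What is kept of joint Gaussianity for moments: the ratio of fourth to squared second moment, on
    a class closed under linear combinations, determines all mixed fourth moments. *)
Definition gaussian_space (V : (T -> R) -> Prop) :=
  [/\ forall X, V X -> all_moments P X,
      forall X, V X -> Ex (fun w => X w ^+ 4) = 3 * Ex (fun w => X w ^+ 2) ^+ 2,
      forall X Y, V X -> V Y -> V (fun w => X w + Y w) &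
      forall (c : R) X, V X -> V (fun w => c * X w)].

Variable V : (T -> R) -> Prop.
Hypothesis GV : gaussian_space V.

(* Polarization: the fourth powers of the eight forms a +- b +- c +- e recover
   the product a b c e. *)
Lemma isserlis a b c e : V a -> V b -> V c -> V e ->
  Ex (fun w => a w * b w * c w * e w) =
  Ex (fun w => a w * b w) * Ex (fun w => c w * e w) +
  Ex (fun w => a w * c w) * Ex (fun w => b w * e w) +
  Ex (fun w => a w * e w) * Ex (fun w => b w * c w).
Proof.
move: GV => [Vm V4 VD VZ] Va Vb Vc Ve.
have [Ma Mb Mc Me] := And4 (Vm _ Va) (Vm _ Vb) (Vm _ Vc) (Vm _ Ve).
have MM X Y := @all_moments_mul _ _ _ P X Y.
pose L x y z w := a w + x * b w + y * c w + z * e w.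
have VL x y z : V (L x y z).
  by do 3 (apply: (VD); last exact: VZ).
pose E X Y := Ex (fun w => X w * Y w).
have L2 x y z : Ex (fun w => L x y z w ^+ 2) =
   E a a + x ^+ 2 * E b b + y ^+ 2 * E c c + z ^+ 2 * E e e +
   2 * (x * E a b + y * E a c + z * E a e + x * y * E b c + x * z * E b e + y * z * E c e).
  have := @Ex_lincomb _ _ _ P [:: (1, fun w => a w * a w); (x ^+ 2, fun w => b w * b w);
    (y ^+ 2, fun w => c w * c w); (z ^+ 2, fun w => e w * e w);
    (2 * x, fun w => a w * b w); (2 * y, fun w => a w * c w); (2 * z, fun w => a w * e w);
    (2 * (x * y), fun w => b w * c w); (2 * (x * z), fun w => b w * e w);
    (2 * (y * z), fun w => c w * e w)].
  rewrite !big_cons big_nil /= => H.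
  transitivity (Ex (fun w => \sum_(p <- [:: (1, fun w => a w * a w); (x ^+ 2, fun w => b w * b w);
    (y ^+ 2, fun w => c w * c w); (z ^+ 2, fun w => e w * e w);
    (2 * x, fun w => a w * b w); (2 * y, fun w => a w * c w); (2 * z, fun w => a w * e w);
    (2 * (x * y), fun w => b w * c w); (2 * (x * z), fun w => b w * e w);
    (2 * (y * z), fun w => c w * e w)]) p.1 * p.2 w)).
    by congr Ex; apply/funext => w; rewrite !big_cons big_nil /= /L; ring.
  rewrite H; first by rewrite -!/(E _ _); ring.
  by move=> p; do ![case=> [<-|]] => //; exact: MM.
pose l : seq (R * (T -> R)) := [:: (1, fun w => L 1 1 1 w ^+ 4); (-1, fun w => L 1 1 (-1) w ^+ 4);
  (-1, fun w => L 1 (-1) 1 w ^+ 4); (1, fun w => L 1 (-1) (-1) w ^+ 4);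
  (-1, fun w => L (-1) 1 1 w ^+ 4); (1, fun w => L (-1) 1 (-1) w ^+ 4);
  (1, fun w => L (-1) (-1) 1 w ^+ 4); (-1, fun w => L (-1) (-1) (-1) w ^+ 4)].
have H := @Ex_lincomb _ _ _ P l.
(* Each of the eight fourth powers contains a b c e with coefficient 4! times the sign x y z, which
   is also its weight in [l]; 192 = 8 * 24. *)
have : 192 * Ex (fun w => a w * b w * c w * e w) = Ex (fun w => \sum_(p <- l) p.1 * p.2 w).
  rewrite -ExZ; last by apply: (MM) => //; apply: (MM) => //; exact: MM.
  by congr Ex; apply/funext => w; rewrite /l !big_cons big_nil /= /L; ring.
rewrite H; last first.
  by move=> p; rewrite /l; do ![case=> [<-|]] => //; apply: all_moments_exp; exact: Vm.
rewrite /l !big_cons big_nil /= !(V4 _ (VL _ _ _)) !L2 -!/(E _ _).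
move=> h; apply: (mulfI (_ : 192 != 0 :> R)); first by rewrite pnatr_eq0.
by rewrite h; ring.
Qed.

End isserlis.

(** * Toeplitz sums over the integers *)

Section zsum_theory.
Variable R : realType.
Implicit Types (f g r : int -> R) (F : int -> int -> R).

Lemma zsumD n f g : zsum n (fun i => f i + g i) = zsum n f + zsum n g.
Proof. by rewrite /zsum big_split. Qed.

Lemma zsumN n f : zsum n (fun i => - f i) = - zsum n f.
Proof. by rewrite /zsum sumrN. Qed.

Lemma zsum_sum (I : Type) (s : seq I) n (G : I -> int -> R) :
  zsum n (fun i => \sum_(a <- s) G a i) = \sum_(a <- s) zsum n (G a).
Proof. by rewrite /zsum exchange_big. Qed.

Lemma le_zsum n f g : (forall i, f i <= g i) -> zsum n f <= zsum n g.
Proof. by move=> fg; apply: ler_sum. Qed.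

Lemma zsum_ge0 n f : (forall i, 0 <= f i) -> 0 <= zsum n f.
Proof. by move=> f0; apply: sumr_ge0. Qed.

Lemma eq_zsum n f g : f =1 g -> zsum n f = zsum n g.
Proof. by move=> fg; apply: eq_bigr. Qed.

Lemma zsumS n f : zsum n.+1 f = f (- n.+1%:Z) + zsum n f + f n.+1%:Z.
Proof.
rewrite /zsum mulnS add2n big_ord_recl big_ord_recr /= sub0r addrA; congr (_ + _ + _).
  by apply: eq_bigr => k _; congr f; rewrite /bump /=; lia.
by congr f; rewrite /bump /=; lia.
Qed.

Lemma zsum_nondecreasing f : (forall i, 0 <= f i) ->
  nondecreasing_seq (fun n => zsum n f).
Proof.
move=> f0; apply/nondecreasing_seqP => n; rewrite zsumS.
have := f0 (- n.+1%:Z); have := f0 n.+1%:Z; lra.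
Qed.

Lemma zsum_center_le f n : (forall i, 0 <= f i) -> f 0 <= zsum n f.
Proof.
move=> f0; have := zsum_nondecreasing f0 (leq0n n).
by rewrite {1}/zsum muln0 big_ord1 subrr.
Qed.

(** Enlarging the square by one row and one column adds a border on which the difference l - j takes
    each value from -N to N exactly once. Hence Toeplitz averages are Cesaro means of symmetric
    partial sums. *)
Lemma toeplitz_sum N r :
  \sum_(j < N) \sum_(l < N) r (l%:Z - j%:Z) = \sum_(n < N) zsum n r.
Proof.
elim: N => [|N IH]; first by rewrite !big_ord0.
rewrite big_ord_recr [RHS]big_ord_recr /= -IH.
under eq_bigr do rewrite big_ord_recr /=.
rewrite big_split /= -addrA; congr (_ + _).
rewrite /zsum mul2n -addnn -addnS big_split_ord /= addrC.
rewrite big_ord_recr [in RHS]big_ord_recl /= -!addrA; congr (_ + _); congr (_ + _).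
  by congr r; lia.
rewrite (reindex_inj rev_ord_inj) /=; apply: eq_bigr => i _.
by congr r; rewrite /bump /=; have := ltn_ord i; lia.
Qed.

(** The window k - i, for k < N and i < N, lies inside [-N, N]. *)
Lemma zsum_translate_le f N (i : nat) : (forall k, 0 <= f k) -> (i < N)%N ->
  \sum_(k < N) f (k%:Z - i%:Z) <= zsum N f.
Proof.
move=> f0 iN.
pose h m := f (m%:Z - N%:Z).
have -> : \sum_(k < N) f (k%:Z - i%:Z) = \sum_(N - i <= m < N - i + N) h m.
  rewrite -{1}[(N - i)%N]add0n big_addn addKn big_mkord; apply: eq_bigr => k _.
  by rewrite /h; congr f; lia.
have -> : zsum N f = \sum_(0 <= m < (2 * N).+1) h m by rewrite big_mkord.
rewrite (@big_cat_nat _ _ _ (N - i) 0 (2 * N).+1) /=; [|lia|lia].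
rewrite (@big_cat_nat _ _ _ (N - i + N) (N - i) (2 * N).+1) /=; [|lia|lia].
by rewrite addrCA lerDl addr_ge0// sumr_ge0// => k _; exact: f0.
Qed.

Lemma zsum_reflect_le f N (j : nat) : (forall k, 0 <= f k) -> (j < N)%N ->
  \sum_(i < N) f (j%:Z - i%:Z) <= zsum N f.
Proof.
move=> f0 jN; rewrite (reindex_inj rev_ord_inj) /=.
apply: le_trans (zsum_translate_le f0 (_ : N.-1 - j < N)%N); last by lia.
apply: ler_sum => i _; have := ltn_ord i => iN.
by rewrite (_ : j%:Z - _ = i%:Z - (N.-1 - j)%:Z)//; lia.
Qed.

Lemma zsum2_translate_le F N (i j : nat) : (forall k l, 0 <= F k l) ->
  (i < N)%N -> (j < N)%N ->
  \sum_(k < N) \sum_(l < N) F (k%:Z - i%:Z) (l%:Z - j%:Z) <=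
  zsum N (fun a => zsum N (F a)).
Proof.
move=> F0 iN jN.
apply: (@le_trans _ _ (\sum_(k < N) zsum N (F (k%:Z - i%:Z)))).
  by apply: ler_sum => k _; exact: zsum_translate_le.
by apply: (zsum_translate_le (fun k => zsum_ge0 _ (F0 k))).
Qed.

Lemma cvg_zsum_ge0 f (M : R) : (forall i, 0 <= f i) ->
  (forall n, zsum n f <= M) -> cvgn (fun n => zsum n f).
Proof.
move=> f0 fM; apply: nondecreasing_is_cvgn; first exact: zsum_nondecreasing.
by exists M => _ [n _ <-].
Qed.

(** Write f as (|f| + f) - |f|: both parts are nonnegative with bounded partial sums. *)
Lemma cvg_zsum f (M : R) : (forall n, zsum n (fun i => `|f i|) <= M) ->
  (fun n => zsum n f) @ \oo --> sum1 f.
Proof.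
move=> fM.
have h : (fun n => zsum n f) = (fun n => zsum n (fun i => `|f i| + f i) - zsum n (fun i => `|f i|)).
  by apply/funext => n; rewrite zsumD addrAC subrr add0r.
suff : cvgn (fun n => zsum n f) by [].
rewrite h; apply: is_cvgB; last exact: cvg_zsum_ge0 fM.
apply: (@cvg_zsum_ge0 _ (2 * M)) => [i|n].
  by have := ler_norm (- f i); rewrite normrN; lra.
rewrite zsumD; have := fM n.
have : zsum n f <= zsum n (fun i => `|f i|) by apply: le_zsum => i; exact: ler_norm.
lra.
Qed.

Lemma cvg_mean_toeplitz r (M : R) : (forall n, zsum n (fun i => `|r i|) <= M) ->
  (fun N => N.+1%:R^-1 * \sum_(j < N.+1) \sum_(l < N.+1) r (l%:Z - j%:Z)) @ \oo --> sum1 r.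
Proof.
move=> rM; have := cesaro (cvg_zsum rM).
suff -> : arithmetic_mean (fun n => zsum n r) =
  (fun N => N.+1%:R^-1 * \sum_(j < N.+1) \sum_(l < N.+1) r (l%:Z - j%:Z)) by [].
by apply/funext => N; rewrite /arithmetic_mean /series /= toeplitz_sum big_mkord.
Qed.

(** Rectangles occur because the Toeplitz identity, applied in each direction, yields partial sums
    with two independent sizes, whereas [sum2] is a limit over squares. *)
Definition zbox F n m : R := zsum n (fun i => zsum m (F i)).

Lemma zboxD F G n m : zbox (fun i j => F i j + G i j) n m = zbox F n m + zbox G n m.
Proof. by rewrite /zbox -zsumD; apply: eq_zsum => i; rewrite zsumD. Qed.

Lemma zboxN F n m : zbox (fun i j => - F i j) n m = - zbox F n m.
Proof. by rewrite /zbox -zsumN; apply: eq_zsum => i; rewrite zsumN. Qed.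

Lemma le_zbox F n m n' m' : (forall i j, 0 <= F i j) -> (n <= n')%N -> (m <= m')%N ->
  zbox F n m <= zbox F n' m'.
Proof.
move=> F0 nn mm; apply: (@le_trans _ _ (zbox F n m')).
  by apply: le_zsum => i; exact: (zsum_nondecreasing (F0 i)).
by apply: (@zsum_nondecreasing (fun i => zsum m' (F i))) => // i; exact: zsum_ge0.
Qed.

(** Both |F| + F and |F| - F are nonnegative, so their sums grow with the box; the two inequalities
    give the absolute value. *)
Lemma zbox_dist F n m k : (n <= k)%N -> (m <= k)%N ->
  `|zbox F k k - zbox F n m| <=
  zbox (fun i j => `|F i j|) k k - zbox (fun i j => `|F i j|) n m.
Proof.
move=> nk mk.
have h1 : zbox (fun i j => `|F i j| + F i j) n m <= zbox (fun i j => `|F i j| + F i j) k k.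
  by apply: le_zbox => // i j; have := ler_norm (- F i j); rewrite normrN; lra.
have h2 : zbox (fun i j => `|F i j| - F i j) n m <= zbox (fun i j => `|F i j| - F i j) k k.
  by apply: le_zbox => // i j; rewrite subr_ge0 ler_norm.
move: h1 h2; rewrite !zboxD !zboxN ler_norml; lra.
Qed.

(** * Absolutely summable kernels in two indices *)

Section abs_summable.
Variables (F : int -> int -> R) (M : R).
Hypothesis FM : forall n, zbox (fun i j => `|F i j|) n n <= M.

Let A n := zbox (fun i j => `|F i j|) n n.
(** The mass of |F| outside the square [-n, n]^2. *)
Let t n := limn A - A n.

Let A_nd : nondecreasing_seq A.
Proof. by move=> n m nm; apply: le_zbox. Qed.

Let cvgA : cvgn A.
Proof. by apply: nondecreasing_is_cvgn => //; exists M => _ [n _ <-]; exact: FM. Qed.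

Let t_ge0 n : 0 <= t n.
Proof. by rewrite subr_ge0; exact: nondecreasing_cvgn_le. Qed.

Let t_cvg0 : t @ \oo --> 0.
Proof. by rewrite -(subrr (limn A)); apply: cvgB => //; exact: cvg_cst. Qed.

Lemma cvg_sum2 : (fun n => zbox F n n) @ \oo --> sum2 F.
Proof.
have h : (fun n => zbox F n n) = (fun n => zbox (fun i j => `|F i j| + F i j) n n - A n).
  by apply/funext => n; rewrite zboxD addrAC subrr add0r.
suff : cvgn (fun n => zbox F n n) by [].
rewrite h; apply: is_cvgB => //; apply: nondecreasing_is_cvgn.
  move=> n m nm; apply: le_zbox => // i j.
  by have := ler_norm (- F i j); rewrite normrN; lra.
exists (2 * M) => _ [n _ <-]; rewrite zboxD.
have := FM n; have : zbox F n n <= zbox (fun i j => `|F i j|) n n; last by lra.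
by apply: le_zsum => i; apply: le_zsum => j; exact: ler_norm.
Qed.

(** The rectangle contains the square of size [minn n m], whose tail is [t n] or [t m]. A bound by a
    sum separates the two indices. *)
Lemma zbox_sum2_dist n m : `|sum2 F - zbox F n m| <= t n + t m.
Proof.
have c : (fun k => `|zbox F k k - zbox F n m|) @ \oo --> `|sum2 F - zbox F n m|.
  by apply: cvg_norm; apply: cvgB; [exact: cvg_sum2|exact: cvg_cst].
apply: (ler_cvg_to c (cvg_cst (t n + t m))); near=> k.
have nk : (n <= k)%N by near: k; exact: nbhs_infty_ge.
have mk : (m <= k)%N by near: k; exact: nbhs_infty_ge.
apply: (le_trans (zbox_dist F nk mk)).
have Ak : A k <= limn A by exact: nondecreasing_cvgn_le.
have Amin : A (minn n m) <= zbox (fun i j => `|F i j|) n m.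
  by apply: le_zbox => //; rewrite ?geq_minl ?geq_minr.
have := t_ge0 n; have := t_ge0 m; rewrite /t.
rewrite -/(A k); move: Amin; rewrite /minn; case: ifP => _; lra.
Unshelve. all: by end_near. Qed.

Lemma zbox_sum_toeplitz N :
  \sum_(i < N) \sum_(j < N) \sum_(k < N) \sum_(l < N) F (k%:Z - i%:Z) (l%:Z - j%:Z) =
  \sum_(n < N) \sum_(m < N) zbox F n m.
Proof.
transitivity (\sum_(i < N) \sum_(k < N) \sum_(j < N) \sum_(l < N) F (k%:Z - i%:Z) (l%:Z - j%:Z)).
  by apply: eq_bigr => i _; rewrite exchange_big.
under eq_bigr do under eq_bigr do rewrite toeplitz_sum.
rewrite (toeplitz_sum N (fun h => \sum_(n < N) zsum n (F h))).
by apply: eq_bigr => n _; rewrite zsum_sum.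
Qed.

(** The error is at most the average of [t n + t m] over the grid, that is, twice the Cesaro mean of
    [t], which tends to zero. *)
Lemma cvg_mean2_toeplitz :
  (fun N => N.+1%:R ^- 2 * \sum_(i < N.+1) \sum_(j < N.+1) \sum_(k < N.+1)
     \sum_(l < N.+1) F (k%:Z - i%:Z) (l%:Z - j%:Z)) @ \oo --> sum2 F.
Proof.
under eq_fun do rewrite zbox_sum_toeplitz.
have ct := cesaro t_cvg0.
apply/cvgrPdist_le => e e0; near=> N.
set N1 := N.+1%:R.
have N0 : 0 < N1 :> R by rewrite ltr0n.
have -> : sum2 F - N1 ^- 2 * \sum_(n < N.+1) \sum_(m < N.+1) zbox F n m =
  N1 ^- 2 * \sum_(n < N.+1) \sum_(m < N.+1) (sum2 F - zbox F n m).
  have -> : \sum_(n < N.+1) \sum_(m < N.+1) (sum2 F - zbox F n m) =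
    N1 ^+ 2 * sum2 F - \sum_(n < N.+1) \sum_(m < N.+1) zbox F n m.
    under eq_bigr do rewrite sumrB sumr_const card_ord.
    by rewrite sumrB sumr_const card_ord -mulrnA -mulr_natl natrM expr2.
  by rewrite mulrBr mulrA mulVf ?mul1r// sqrf_eq0 gt_eqF.
rewrite normrM ger0_norm ?invr_ge0 ?sqr_ge0//.
have h : `|\sum_(n < N.+1) \sum_(m < N.+1) (sum2 F - zbox F n m)| <=
   2 * N1 * \sum_(n < N.+1) t n.
  apply: (@le_trans _ _ (\sum_(n < N.+1) \sum_(m < N.+1) (t n + t m))).
    apply: (le_trans (ler_norm_sum _ _ _)); apply: ler_sum => n _.
    apply: (le_trans (ler_norm_sum _ _ _)); apply: ler_sum => m _.
    exact: zbox_sum2_dist.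
  under eq_bigr do rewrite big_split /= sumr_const card_ord.
  rewrite big_split /= sumr_const card_ord sumrMnl -mulr_natl -/N1 -mulr_natl -/N1.
  lra.
apply: (@le_trans _ _ (N1 ^- 2 * (2 * N1 * \sum_(n < N.+1) t n))).
  by rewrite ler_wpM2l// invr_ge0 sqr_ge0.
have -> : N1 ^- 2 * (2 * N1 * \sum_(n < N.+1) t n) = 2 * arithmetic_mean t N.
  by rewrite /arithmetic_mean /series /= big_mkord -/N1; field; rewrite gt_eqF.
have : `|arithmetic_mean t N| <= e / 2.
  near: N; apply: cvgr0_norm_le => //; by rewrite divr_gt0.
have := ler_norm (arithmetic_mean t N); lra.
Unshelve. all: by end_near. Qed.

End abs_summable.
End zsum_theory.

(** * Gaussian matrices and convergence in distribution *)

Section finite_double_sums.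
Variables (R : realType) (N : nat) (f : 'I_N -> 'I_N -> R).
Hypothesis f0 : forall i j, 0 <= f i j.

Lemma row_sum_le i : \sum_j f i j <= \sum_a \sum_b f a b.
Proof. by rewrite [leRHS](bigD1 i)//= lerDl; do 2 apply: sumr_ge0 => ? _. Qed.

Lemma entry_le i j : f i j <= \sum_a \sum_b f a b.
Proof.
apply: le_trans (row_sum_le i).
by rewrite (bigD1 j)//= lerDl; apply: sumr_ge0 => ? _.
Qed.

End finite_double_sums.

Section gaussian_matrix_moments.
Context {d : measure_display} {T : measurableType d} {R : realType}.
Variables (P : probability T R) (V : (T -> R) -> Prop).
Hypothesis GV : gaussian_space P V.
Local Notation Ex := (mean P).
Variables (N : nat) (W : 'I_N -> 'I_N -> T -> R) (K : R).
Hypothesis VW : forall i j, V (W i j).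
Let c i j k l := Ex (fun w => W i j w * W k l w).
Hypothesis cK : forall i j, \sum_k \sum_l `|c i j k l| <= K.

Let aW i j : all_moments P (W i j).
Proof. by case: GV => Vm _ _ _; exact: Vm. Qed.

Let c_le i j k l : `|c i j k l| <= K.
Proof. by apply: le_trans (cK i j); apply: (@entry_le _ _ (fun k l => `|c i j k l|)). Qed.

Let sum_cst (x : R) : \sum_(i < N) x = N%:R * x.
Proof. by rewrite sumr_const card_ord mulr_natl. Qed.

(** For fixed i, j each of the three Isserlis pairings is a product of two covariances. The one
    involving the pair (i, j) is summed over k and l, the other is bounded by K. *)
Lemma Ex_frob_square_le :
  Ex (fun w => \sum_i \sum_k (\sum_j W i j w * W j k w) ^+ 2) <= 3 * K ^+ 2 * N%:R ^+ 3.
Proof.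
(* The indices matter: nonnegativity of K is read off an entry, so it is available only when N >
   0. *)
have K0 (i j : 'I_N) : 0 <= K by exact: le_trans (normr_ge0 _) (c_le i j i j).
have aWW i j k l : all_moments P (fun w => W i j w * W k l w) by exact: all_moments_mul.
have -> : Ex (fun w => \sum_i \sum_k (\sum_j W i j w * W j k w) ^+ 2) =
   \sum_i \sum_j \sum_k \sum_l
     (c i j j k * c i l l k + c i j i l * c j k l k + c i j l k * c j k i l).
  rewrite Ex_sum; last first.
    by move=> i; apply: all_moments_sum => k; apply: all_moments_exp; exact: all_moments_sum.
  apply: eq_bigr => i _; rewrite exchange_big /=.
  rewrite Ex_sum; last by move=> k; apply: all_moments_exp; exact: all_moments_sum.
  apply: eq_bigr => k _.
  under eq_fun do rewrite expr2 big_distrlr /=.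
  rewrite Ex_sum; last by move=> j; apply: all_moments_sum => l; exact: all_moments_mul.
  apply: eq_bigr => j _; rewrite Ex_sum; last by move=> l; exact: all_moments_mul.
  apply: eq_bigr => l _.
  under eq_fun do rewrite mulrA.
  by rewrite (isserlis GV).
apply: (@le_trans _ _ (\sum_(i < N) \sum_(j < N) (3 * N%:R * K ^+ 2))); last first.
  by rewrite !sum_cst le_eqVlt; apply/orP; left; apply/eqP; ring.
apply: ler_sum => i _; apply: ler_sum => j _.
have N1 : 1 <= N%:R :> R by rewrite ler1n (leq_ltn_trans _ (ltn_ord i)).
(* A covariance free of one summation index costs a factor N, as here and in [h2]; in [h3] both
   indices occur and the row bound K is enough. *)
have h1 : \sum_k \sum_(l < N) `|c i j j k| <= N%:R * K.
  under eq_bigr do rewrite sum_cst.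
  rewrite -mulr_sumr ler_wpM2l//; apply: le_trans (cK i j).
  exact: (@row_sum_le _ _ (fun a b => `|c i j a b|)).
have h2 : \sum_(k < N) \sum_l `|c i j i l| <= N%:R * K.
  rewrite sum_cst ler_wpM2l//; apply: le_trans (cK i j).
  exact: (@row_sum_le _ _ (fun a b => `|c i j a b|)).
have h3 : \sum_k \sum_l `|c i j l k| <= N%:R * K.
  rewrite exchange_big; apply: le_trans (cK i j) _.
  by rewrite ler_peMl//; exact: K0.
have -> : 3 * N%:R * K ^+ 2 = K * (N%:R * K + N%:R * K + N%:R * K) by ring.
apply: le_trans (ler_wpM2l (K0 i j) (lerD (lerD h1 h2) h3)).
rewrite -!big_split /= mulr_sumr; apply: ler_sum => k _.
rewrite -!big_split /= mulr_sumr; apply: ler_sum => l _.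
rewrite !mulrDr; apply: le_trans (ler_norm _) _.
apply: le_trans (ler_normD _ _) _; apply: lerD; last first.
  by rewrite normrM mulrC ler_wpM2r.
apply: le_trans (ler_normD _ _) _.
by apply: lerD; rewrite normrM mulrC ler_wpM2r.
Qed.

Let S i w := \sum_j W i j w.

Lemma gaussian_space_sum (I : Type) (r : seq I) (X : I -> T -> R) : V (cst 0) ->
  (forall i, V (X i)) -> V (fun w => \sum_(i <- r) X i w).
Proof.
case: GV => _ _ VD _ V0 VX; elim: r => [|i r IH].
  by under eq_fun do rewrite big_nil.
by under eq_fun do rewrite big_cons; exact: VD.
Qed.

(** By Isserlis, S_i^2 and S_k^2 have covariance 2 s_ik^2. Since the |s_ik| sum over k to at most N
    K, the sum of their squares over i and k is at most N (N K)^2. *)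
Lemma Var_sum_row_squares_le : V (cst 0) ->
  Ex (fun w => (\sum_i S i w ^+ 2 - \sum_i Ex (fun w => S i w ^+ 2)) ^+ 2) <=
  2 * K ^+ 2 * N%:R ^+ 3.
Proof.
move=> V0.
have K0 (i : 'I_N) : 0 <= K by exact: le_trans (normr_ge0 _) (c_le i i i i).
have VS i : V (S i) by exact: gaussian_space_sum.
have aS i : all_moments P (S i) by case: GV => Vm _ _ _; exact: Vm.
have aS2 i : all_moments P (fun w => S i w ^+ 2) by exact: all_moments_exp.
pose s i k := Ex (fun w => S i w * S k w).
have sE i : Ex (fun w => S i w ^+ 2) = s i i by [].
set mu := \sum_i _.
have muE : Ex (fun w => \sum_i S i w ^+ 2) = mu by exact: Ex_sum.
have aSS : all_moments P (fun w => \sum_i S i w ^+ 2) by exact: all_moments_sum.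
have -> : Ex (fun w => (\sum_i S i w ^+ 2 - mu) ^+ 2) = 2 * \sum_i \sum_k s i k ^+ 2.
  have E1 : Ex (fun w => (\sum_i S i w ^+ 2) ^+ 2) = \sum_i \sum_k (s i i * s k k + 2 * s i k ^+ 2).
    under eq_fun do rewrite expr2 big_distrlr /=.
    rewrite Ex_sum; last by move=> i; apply: all_moments_sum => k; exact: all_moments_mul.
    apply: eq_bigr => i _; rewrite Ex_sum; last by move=> k; exact: all_moments_mul.
    apply: eq_bigr => k _.
    under eq_fun do rewrite !expr2 mulrA.
    by rewrite (isserlis GV)// -!/(s _ _); ring.
  pose l : seq (R * (T -> R)) := [:: (1, fun w => (\sum_i S i w ^+ 2) ^+ 2);
     (- (2 * mu), fun w => \sum_i S i w ^+ 2); (mu ^+ 2, cst 1)].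
  transitivity (Ex (fun w => \sum_(p <- l) p.1 * p.2 w)).
    by congr Ex; apply/funext => w; rewrite /l !big_cons big_nil /=; ring.
  rewrite Ex_lincomb; last first.
    by move=> p; do ![case=> [<-|]] => //=; [exact: all_moments_exp|exact: all_moments_cst].
  rewrite /l !big_cons big_nil /= E1 muE Ex_cst.
  have -> : \sum_i \sum_k (s i i * s k k + 2 * s i k ^+ 2) =
            mu * mu + 2 * \sum_i \sum_k s i k ^+ 2.
    rewrite big_distrlr mulr_sumr -big_split /=; apply: eq_bigr => i _.
    by rewrite mulr_sumr -big_split.
  ring.
have sb i : \sum_k `|s i k| <= N%:R * K.
  apply: (@le_trans _ _ (\sum_k \sum_j \sum_l `|c i j k l|)).
    apply: ler_sum => k _; rewrite /s.
    under eq_fun do rewrite big_distrlr /=.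
    rewrite Ex_sum; last by move=> j; apply: all_moments_sum => l; exact: all_moments_mul.
    apply: le_trans (ler_norm_sum _ _ _) _; apply: ler_sum => j _.
    rewrite Ex_sum; last by move=> l; exact: all_moments_mul.
    exact: ler_norm_sum.
  rewrite exchange_big /= -sum_cst; apply: ler_sum => j _; exact: cK.
have se i k : `|s i k| <= N%:R * K.
  apply: le_trans (sb i); rewrite (bigD1 k)//= lerDl.
  by apply: sumr_ge0 => ? _.
rewrite (_ : 2 * K ^+ 2 * N%:R ^+ 3 = 2 * (N%:R * ((N%:R * K) * (N%:R * K)))); last by ring.
rewrite ler_wpM2l// -sum_cst; apply: ler_sum => i _.
apply: (@le_trans _ _ (N%:R * K * \sum_k `|s i k|)).
  rewrite mulr_sumr; apply: ler_sum => k _.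
  by rewrite -real_normK ?num_real// expr2 ler_wpM2r.
by rewrite ler_wpM2l// mulr_ge0//; exact: K0.
Qed.

End gaussian_matrix_moments.

(** * Slutsky's lemma for distribution functions *)

Section slutsky.
Context {d : measure_display} {T : measurableType d} {R : realType}.
Variables (P : probability T R) (L b : nat -> T -> R) (v : nat -> R) (alpha s2 : R).
Hypothesis mL : forall n x, measurable [set w | L n w <= x].
Hypothesis mb : forall n x, measurable [set w | b n w <= x].
Hypothesis s20 : 0 < s2.
Hypothesis vs : v @ \oo --> s2.
Hypothesis cdfb : \forall n \near \oo, forall t,
  fine (P [set w | b n w <= t]) = std_cdf (t / Num.sqrt (v n)).
Hypothesis small : forall e, 0 < e -> exists B : nat -> set T,
  [/\ forall n, measurable (B n), (fun n => fine (P (B n))) @ \oo --> 0 &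
   \forall n \near \oo, forall w, ~ B n w -> `|L n w - b n w - alpha| <= e].

(** Outside [B n], the event L <= x lies between b <= y - e and b <= y + e, with y = x - alpha. The
    error splits in three: continuity of the limit, change of variance, probability of [B n]. *)
Lemma slutsky x :
  (fun n => fine (P [set w | L n w <= x])) @ \oo --> std_cdf ((x - alpha) / Num.sqrt s2).
Proof.
have cv t : (fun n => std_cdf (t / Num.sqrt (v n))) @ \oo --> std_cdf (t / Num.sqrt s2).
  apply: continuous_cvg; first exact: std_cdf_continuous.
  apply: cvgM; first exact: cvg_cst.
  apply: cvgV; first by rewrite gt_eqF// sqrtr_gt0.
  by apply: continuous_cvg => //; exact: sqrt_continuous.
apply/cvgrPdist_le => dl dl0.
have d3 : 0 < dl / 3 by rewrite divr_gt0.
set y := x - alpha.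
have [e e0 he] : exists2 e, 0 < e &
   forall h, `|h| <= e -> `|std_cdf (y / Num.sqrt s2) - std_cdf ((y + h) / Num.sqrt s2)| <= dl / 3.
  have : (fun h => std_cdf ((y + h) / Num.sqrt s2)) @ (0 : R) --> std_cdf (y / Num.sqrt s2).
    rewrite -{2}[y]addr0; apply: continuous_cvg; first exact: std_cdf_continuous.
    by apply: cvgM; [apply: cvgD; [exact: cvg_cst|exact: cvg_id]|exact: cvg_cst].
  move=> /cvgrPdist_le/(_ _ d3) /nbhs_norm0P[e /= e0 he].
  (* Halving passes from the open ball of the neighborhood to a closed one. *)
  exists (e / 2); first by rewrite divr_gt0.
  by move=> h hh; apply: he => /=; rewrite (le_lt_trans hh)// ltr_pdivrMr// ltr_pMr// ltr1n.
have [B [mB B0 hB]] := small e0.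
have fin A : measurable A -> P A \is a fin_num by move=> mA; exact: fin_num_measure.
have sub A A' C : measurable A -> measurable A' -> measurable C -> A `<=` A' `|` C ->
    fine (P A) <= fine (P A') + fine (P C).
  move=> mA mA' mC AA; rewrite -fineD ?fin// fine_le ?fin//; first by rewrite fin_numD !fin.
  apply: le_trans (le_measure P _ _ AA) _; rewrite ?inE//; first exact: measurableU.
  exact: measureU2.
near=> n.
have cb : forall t, fine (P [set w | b n w <= t]) = std_cdf (t / Num.sqrt (v n)).
  by near: n.
have hn : forall w, ~ B n w -> `|L n w - b n w - alpha| <= e by near: n.
have Bn : `|fine (P (B n))| <= dl / 3 by near: n; exact: cvgr0_norm_le.
have c1 : `|std_cdf ((y + e) / Num.sqrt s2) - std_cdf ((y + e) / Num.sqrt (v n))| <= dl / 3.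
  near: n; by have /cvgrPdist_le/(_ _ d3) := cv (y + e).
have c2 : `|std_cdf ((y + - e) / Num.sqrt s2) - std_cdf ((y + - e) / Num.sqrt (v n))| <= dl / 3.
  near: n; by have /cvgrPdist_le/(_ _ d3) := cv (y + - e).
have e1 := he e; rewrite (gtr0_norm e0) lexx in e1; have {}e1 := e1 isT.
have e2 := he (- e); rewrite normrN (gtr0_norm e0) lexx in e2; have {}e2 := e2 isT.
have u1 : fine (P [set w | L n w <= x]) <= std_cdf ((y + e) / Num.sqrt (v n)) + fine (P (B n)).
  rewrite -cb; apply: sub => // w /= Lx.
  have [Bw|Bw] := pselect (B n w); [by right|left => /=].
  by have := hn w Bw; rewrite ler_norml /y; lra.
have u2 : std_cdf ((y + - e) / Num.sqrt (v n)) <= fine (P [set w | L n w <= x]) + fine (P (B n)).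
  rewrite -cb; apply: sub => // w /= bx.
  have [Bw|Bw] := pselect (B n w); [by right|left => /=].
  by have := hn w Bw; move: bx; rewrite ler_norml /y; lra.
move: Bn c1 c2 e1 e2; rewrite !ler_norml; lra.
Unshelve. all: by end_near. Qed.

End slutsky.

(** * The stationary process *)

Section gaussian_rv_theory.
Context {d : measure_display} {T : measurableType d} {R : realType}.
Variable P : probability T R.
Local Notation Ex := (mean P).

(** The abstract parameters of the law are identified through the moment recursion: m is the mean
    and s^2 the variance. *)
Lemma gaussian_rv_central (X : T -> R) : gaussian_rv P X ->
  all_moments P X /\ exists s : R,
    [/\ Ex (fun w => (X w - Ex X) ^+ 2) = s ^+ 2,
        Ex (fun w => (X w - Ex X) ^+ 4) = 3 * (s ^+ 2) ^+ 2 &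
        s != 0 -> forall t,
          fine (P [set w | X w - Ex X <= t]) = std_cdf (t / `|s|)].
Proof.
move=> [mX [m [s law]]].
have aC : all_moments P (fun w => X w - m) := gaussian_central_integrable mX law.
have XE : X = (fun w => (X w - m) + m) by apply/funext => w; rewrite subrK.
have aX : all_moments P X.
  by rewrite XE; apply: all_moments_add => //; exact: all_moments_cst.
have rec := gaussian_moment_rec mX law.
have EX : Ex X = m.
  rewrite XE ExD//; last exact: all_moments_cst.
  have := rec 0%N; rewrite mulr0 mul0r => E0.
  by rewrite [X in X + _]E0 add0r Ex_cst.
have E2 : Ex (fun w => (X w - m) ^+ 2) = s ^+ 2.
  have := rec 1%N; rewrite mulr1 /= => E0; rewrite [LHS]E0.
  by rewrite -[RHS]mulr1; congr (_ * _); exact: Ex_cst.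
split => //; exists s; rewrite EX; split => //.
  have := rec 3%N; rewrite /= => E0; rewrite [LHS]E0 [X in _ * X]E2; ring.
move=> s0 t.
have -> : [set w | X w - m <= t] = X @^-1` `]-oo, t + m].
  by apply/seteqP; split => w /=; rewrite in_itv /= lerBlDr.
by rewrite law ?(negbTE s0)// normal_prob_cdf// addrK.
Qed.

End gaussian_rv_theory.

Section process.
Context {d : measure_display} {T : measurableType d} {R : realType}.
Variables (P : probability T R) (Z : int -> int -> T -> R) (theta : R).
Hypothesis theta0 : 0 < theta.
Hypothesis GP : gaussian_process P Z.
Hypothesis SM : stationary_mean P Z theta.
Local Notation Ex := (mean P).
Let K := cov_kernel P Z.
Let Y i j w := Z i j w - theta.

Let aZ i j : all_moments P (Z i j).
Proof.
have [+ _] := gaussian_rv_central (GP [:: ((i, j), 1)]).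
by under eq_fun do rewrite big_seq1 mul1r.
Qed.

Let EZ i j : Ex (Z i j) = theta.
Proof. by have := SM.1 i j; rewrite unlock /mean /Rintegral => ->. Qed.

Let aY i j : all_moments P (Y i j).
Proof. by apply: all_moments_add => //; exact: all_moments_cst. Qed.

Lemma Ex_centered_product i j k l :
  Ex (fun w => Y i j w * Y k l w) = K (k - i) (l - j).
Proof.
rewrite /K /cov_kernel -SM.2 unlock unlock.
rewrite [LHS]/Rintegral; congr fine; apply: eq_integral => w _.
change ((Y i j w * Y k l w)%:E = ((Z i j w - Ex (Z i j)) * (Z k l w - Ex (Z k l)))%:E).
by rewrite !EZ.
Qed.

(** The lists have the format of [gaussian_process], so each member is a Gaussian variable minus its
    mean. *)
Definition centered_span (X : T -> R) := exists l : seq ((int * int) * R),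
  X = (fun w => \sum_(p <- l) p.2 * Y p.1.1 p.1.2 w).

Let centered_spanE l : (fun w => \sum_(p <- l) p.2 * Y p.1.1 p.1.2 w) =
  (fun w => \sum_(p <- l) p.2 * Z p.1.1 p.1.2 w -
     Ex (fun w => \sum_(p <- l) p.2 * Z p.1.1 p.1.2 w)).
Proof.
rewrite Ex_sum; last by move=> p; exact: all_moments_scale.
apply/funext => w; rewrite -sumrB; apply: eq_bigr => p _.
by rewrite ExZ// EZ /Y mulrBr.
Qed.

Lemma centered_span_gaussian : gaussian_space P centered_span.
Proof.
split.
- move=> _ [l ->]; apply: all_moments_sum => p; exact: all_moments_scale.
- move=> X [l XE].
  pose Xl w := \sum_(p <- l) p.2 * Z p.1.1 p.1.2 w.
  have {}XE : X = (fun w => Xl w - Ex Xl) by rewrite XE centered_spanE.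
  have [_ [s [E2 E4 _]]] := gaussian_rv_central (GP l : gaussian_rv P Xl).
  by rewrite XE E4 E2.
- move=> _ _ [l1 ->] [l2 ->]; exists (l1 ++ l2).
  by apply/funext => w; rewrite big_cat.
- move=> c _ [l ->]; exists [seq (p.1, c * p.2) | p <- l].
  apply/funext => w; rewrite big_map mulr_sumr; apply: eq_bigr => p _ /=.
  by rewrite mulrA.
Qed.

Let V0 : centered_span (cst 0).
Proof. by exists [::]; apply/funext => w; rewrite big_nil. Qed.

Let VY i j : centered_span (Y i j).
Proof. by exists [:: ((i, j), 1)]; apply/funext => w; rewrite big_seq1 mul1r. Qed.

Lemma centered_span_cdf X t : centered_span X -> 0 < Ex (fun w => X w ^+ 2) ->
  fine (P [set w | X w <= t]) = std_cdf (t / Num.sqrt (Ex (fun w => X w ^+ 2))).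
Proof.
move=> [l XE].
pose Xl w := \sum_(p <- l) p.2 * Z p.1.1 p.1.2 w.
have {}XE : X = (fun w => Xl w - Ex Xl) by rewrite XE centered_spanE.
have [_ [s [E2 _ cdf]]] := gaussian_rv_central (GP l : gaussian_rv P Xl).
by rewrite XE E2 exprn_even_gt0//= => s0; rewrite sqrtr_sqr cdf.
Qed.

Variable M : R.
Hypothesis KM : forall n, zbox (fun i j => `|K i j|) n n <= M.

(** * Estimates at a fixed matrix size *)

Section size.
Variable n : nat.
Let N := n.+1.
Let N1 : R := N%:R.
Let Yo (i j : 'I_N) := Y (nat_of_ord i).+1%:Z (nat_of_ord j).+1%:Z.
Definition noise (i j : 'I_N) (w : T) : R := Yo i j w + Yo j i w.

Let N10 : 0 < N1. Proof. by rewrite ltr0n. Qed.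

Let cY (i j k l : 'I_N) :
  Ex (fun w => Yo i j w * Yo k l w) = K (k%:Z - i%:Z) (l%:Z - j%:Z).
Proof. by rewrite Ex_centered_product; congr K; lia. Qed.

Let aYo i j : all_moments P (Yo i j). Proof. exact: aY. Qed.

Let aYY i j k l : all_moments P (fun w => Yo i j w * Yo k l w).
Proof. exact: all_moments_mul. Qed.

Lemma centered_span_noise i j : centered_span (noise i j).
Proof. by have [_ _ VD _] := centered_span_gaussian; exact: VD (VY _ _) (VY _ _). Qed.

Let aW i j : all_moments P (noise i j).
Proof. exact: all_moments_add. Qed.

Lemma Ex_noise_product i j k l : Ex (fun w => noise i j w * noise k l w) =
  K (k%:Z - i%:Z) (l%:Z - j%:Z) + K (l%:Z - i%:Z) (k%:Z - j%:Z) +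
  (K (k%:Z - j%:Z) (l%:Z - i%:Z) + K (l%:Z - j%:Z) (k%:Z - i%:Z)).
Proof.
rewrite -!cY.
transitivity (Ex (fun w => (Yo i j w * Yo k l w + Yo i j w * Yo l k w) +
   (Yo j i w * Yo k l w + Yo j i w * Yo l k w))).
  by congr Ex; apply/funext => w; rewrite /noise; ring.
by rewrite !ExD//; exact: all_moments_add.
Qed.

Let KM1 (i j : 'I_N) :
  \sum_(k < N) \sum_(l < N) `|K (k%:Z - i%:Z) (l%:Z - j%:Z)| <= M.
Proof.
apply: le_trans (KM N).
exact: (@zsum2_translate_le _ (fun a b => `|K a b|)).
Qed.

(** The hypothesis [cK] of the moment bounds with K = 4 M, uniformly in the matrix size. *)
Lemma noise_row_bound i j :
  \sum_k \sum_l `|Ex (fun w => noise i j w * noise k l w)| <= 4 * M.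
Proof.
apply: (@le_trans _ _ (\sum_(k < N) \sum_(l < N)
  ((`|K (k%:Z - i%:Z) (l%:Z - j%:Z)| + `|K (l%:Z - i%:Z) (k%:Z - j%:Z)|) +
   (`|K (k%:Z - j%:Z) (l%:Z - i%:Z)| + `|K (l%:Z - j%:Z) (k%:Z - i%:Z)|)))).
  apply: ler_sum => k _; apply: ler_sum => l _; rewrite Ex_noise_product.
  by apply: le_trans (ler_normD _ _) _; apply: lerD; exact: ler_normD.
under eq_bigr do rewrite !big_split /=.
rewrite !big_split /=.
have h1 := KM1 i j; have h2 := KM1 j i.
have h3 : \sum_(k < N) \sum_(l < N) `|K (l%:Z - i%:Z) (k%:Z - j%:Z)| <= M.
  by rewrite exchange_big.
have h4 : \sum_(k < N) \sum_(l < N) `|K (l%:Z - j%:Z) (k%:Z - i%:Z)| <= M.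
  by rewrite exchange_big.
lra.
Qed.

(** This is e.We in closed form; each centered entry is counted twice by the symmetrization. *)
Definition fluct (w : T) : R := 2 / N1 * \sum_i \sum_j Yo i j w.

Lemma centered_span_fluct : centered_span fluct.
Proof.
have GV := centered_span_gaussian.
have [_ _ _ VZ] := GV; apply: (VZ).
by apply: (gaussian_space_sum GV) => // i; apply: (gaussian_space_sum GV) => // j; exact: VY.
Qed.

Lemma Ex_fluct_sqr : Ex (fun w => fluct w ^+ 2) =
  4 * (N1 ^- 2 * \sum_(i < N) \sum_(j < N) \sum_(k < N) \sum_(l < N)
    K (k%:Z - i%:Z) (l%:Z - j%:Z)).
Proof.
under eq_fun do rewrite /fluct exprMn.
have aR i : all_moments P (fun w => \sum_j Yo i j w) by exact: all_moments_sum.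
rewrite ExZ; last by apply: all_moments_exp; exact: all_moments_sum.
rewrite mulrA; congr (_ * _); first by rewrite expr_div_n -natrX.
under eq_fun do rewrite expr2 big_distrlr /=.
rewrite Ex_sum; last by move=> i; apply: all_moments_sum => k; exact: all_moments_mul.
apply: eq_bigr => i _; rewrite exchange_big /=.
rewrite Ex_sum; last by move=> k; exact: all_moments_mul.
apply: eq_bigr => k _.
under eq_fun do rewrite big_distrlr /=.
rewrite Ex_sum; last by move=> j; exact: all_moments_sum.
apply: eq_bigr => j _; rewrite Ex_sum//.
by apply: eq_bigr => l _; rewrite cY.
Qed.

Lemma Ex_fluct_sqr_le : Ex (fun w => fluct w ^+ 2) <= 4 * M.
Proof.
rewrite Ex_fluct_sqr ler_wpM2l// mulrC ler_pdivrMr ?exprn_gt0//.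
apply: (@le_trans _ _ (\sum_(i < N) \sum_(j < N) M)); last first.
  by rewrite !sumr_const !card_ord -mulrnA -mulr_natr natrM expr2.
apply: ler_sum => i _; apply: ler_sum => j _; apply: le_trans (KM1 i j).
by apply: ler_sum => k _; apply: ler_sum => l _; exact: ler_norm.
Qed.

(** The coordinates of We, multiplied by sqrt N. *)
Definition row_noise (i : 'I_N) (w : T) : R := \sum_j noise i j w.

Let mu := \sum_i Ex (fun w => row_noise i w ^+ 2).

(** Of the four covariances in E(W_ij W_il), two have a zero argument and do not depend on i: they
    give the kernel of alpha. The other two, for fixed i, are absolutely summable over j and l, so
    they add at most 2 N M to [mu]. *)
Lemma row_noise_mean : `|N1 ^- 2 * mu -
   N1^-1 * \sum_(j < N) \sum_(l < N) (K (l%:Z - j%:Z) 0 + K 0 (l%:Z - j%:Z))| <= 2 * M / N1.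
Proof.
have sum_cst x : \sum_(i < N) x = N1 * x by rewrite sumr_const card_ord mulr_natl.
pose r h := K h 0 + K 0 h.
pose E1 := \sum_(i < N) \sum_(j < N) \sum_(l < N) K (l%:Z - i%:Z) (i%:Z - j%:Z).
pose E2 := \sum_(i < N) \sum_(j < N) \sum_(l < N) K (i%:Z - j%:Z) (l%:Z - i%:Z).
have muE : mu = N1 * \sum_(j < N) \sum_(l < N) r (l%:Z - j%:Z) + (E1 + E2).
  rewrite /E1 /E2 -sum_cst -!big_split /=.
  apply: eq_bigr => i _.
  under eq_fun do rewrite expr2 big_distrlr /=.
  rewrite Ex_sum; last by move=> j; apply: all_moments_sum => l; exact: all_moments_mul.
  rewrite -!big_split /=; apply: eq_bigr => j _.
  rewrite Ex_sum; last by move=> l; exact: all_moments_mul.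
  rewrite -!big_split /=; apply: eq_bigr => l _.
  by rewrite Ex_noise_product /r !subrr; ring.
have E1M : `|E1| <= N1 * M.
  rewrite -sum_cst.
  apply: le_trans (ler_norm_sum _ _ _) _; apply: ler_sum => i _.
  apply: le_trans (ler_norm_sum _ _ _) _.
  apply: (@le_trans _ _ (\sum_(j < N) \sum_(l < N) `|K (l%:Z - i%:Z) (i%:Z - j%:Z)|)).
    by apply: ler_sum => j _; exact: ler_norm_sum.
  rewrite exchange_big /=; apply: le_trans (KM N).
  apply: (@le_trans _ _ (\sum_(l < N) zsum N (fun a => `|K (l%:Z - i%:Z) a|))).
    by apply: ler_sum => l _; apply: (@zsum_reflect_le _ (fun a => `|K (l%:Z - i%:Z) a|)).
  apply: (@zsum_translate_le _ (fun b => zsum N (fun a => `|K b a|))) => // b.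
  exact: zsum_ge0.
have E2M : `|E2| <= N1 * M.
  rewrite -sum_cst.
  apply: le_trans (ler_norm_sum _ _ _) _; apply: ler_sum => i _.
  apply: le_trans (ler_norm_sum _ _ _) _.
  apply: (@le_trans _ _ (\sum_(j < N) \sum_(l < N) `|K (i%:Z - j%:Z) (l%:Z - i%:Z)|)).
    by apply: ler_sum => j _; exact: ler_norm_sum.
  apply: le_trans (KM N).
  apply: (@le_trans _ _ (\sum_(j < N) zsum N (fun a => `|K (i%:Z - j%:Z) a|))).
    by apply: ler_sum => j _; apply: (@zsum_translate_le _ (fun a => `|K (i%:Z - j%:Z) a|)).
  apply: (@zsum_reflect_le _ (fun b => zsum N (fun a => `|K b a|))) => // b.
  exact: zsum_ge0.
have -> : N1 ^- 2 * mu - N1^-1 * \sum_(j < N) \sum_(l < N) r (l%:Z - j%:Z) =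
   N1 ^- 2 * (E1 + E2).
  by rewrite muE; field; rewrite gt_eqF.
rewrite normrM ger0_norm ?invr_ge0 ?sqr_ge0// mulrC ler_pdivrMr ?exprn_gt0//.
rewrite expr2 mulrA divfK ?gt_eqF//.
by apply: le_trans (ler_normD _ _) _; lra.
Qed.

Let row_sq w := \sum_i row_noise i w ^+ 2.
Let frob2 w := \sum_i \sum_k (\sum_j noise i j w * noise j k w) ^+ 2.
Let a := 2 * N1 * theta.
Let a0 : 0 < a. Proof. by rewrite !mulr_gt0. Qed.
Let Wm w : 'M[R]_N := \matrix_(i, j) noise i j w.
Let rN := Num.sqrt N1.
Let e : 'rV[R]_N := const_mx rN^-1.

Let rN2 : rN^-1 * rN^-1 = N1^-1.
Proof. by rewrite -invfM -expr2 sqr_sqrtr// ltW. Qed.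

Let noiseC i j w : noise i j w = noise j i w.
Proof. by rewrite /noise addrC. Qed.

Let WmT w : (Wm w)^T = Wm w.
Proof. by apply/matrixP => i j; rewrite !mxE noiseC. Qed.

Let e1 : dot e e = 1.
Proof.
rewrite dotE; under eq_bigr do rewrite !mxE rN2.
by rewrite sumr_const card_ord -mulr_natr mulVf// gt_eqF.
Qed.

Let AN_decomposition w : AN Z N w = a *: (e^T *m e) + Wm w.
Proof.
apply/matrixP => i j; rewrite !mxE big_ord1 !mxE rN2 /noise /Yo /Y.
by rewrite /a; field; rewrite gt_eqF.
Qed.

Let eW w j : (e *m Wm w) 0 j = rN^-1 * row_noise j w.
Proof.
rewrite mxE /row_noise mulr_sumr; apply: eq_bigr => i _.
by rewrite !mxE noiseC.
Qed.

Let dot_eeW w : dot e (e *m Wm w) = fluct w.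
Proof.
rewrite dotE; under eq_bigr do rewrite eW mxE mulrA rN2.
rewrite -mulr_sumr /fluct [2 / N1]mulrC -mulrA; congr (_ * _).
rewrite /row_noise /noise; under eq_bigr do rewrite big_split /=.
rewrite big_split /= [X in _ + X]exchange_big /=; ring.
Qed.

Let dot_eWeW w : dot (e *m Wm w) (e *m Wm w) = N1^-1 * row_sq w.
Proof.
rewrite dotE /row_sq mulr_sumr; apply: eq_bigr => j _.
by rewrite eW mulrACA rN2 -expr2.
Qed.

(** As [W] is symmetric, |xW|^4 = (x.xW^2)^2 <= |W^2|_F^2 |x|^4. *)
Let opnorm w t : 0 <= t -> frob2 w <= t ^+ 4 ->
  forall x, dot (x *m Wm w) (x *m Wm w) <= t ^+ 2 * dot x x.
Proof.
move=> t0 Gt x.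
have fE : frob (Wm w *m Wm w) = frob2 w.
  apply: eq_bigr => i _; apply: eq_bigr => k _; rewrite mxE; congr (_ ^+ 2).
  by apply: eq_bigr => j _; rewrite !mxE.
have sq : dot (x *m Wm w) (x *m Wm w) ^+ 2 <= (t ^+ 2 * dot x x) ^+ 2.
  rewrite dot_mulmxl WmT -mulmxA.
  apply: le_trans (CauchySchwarz _ _) _.
  apply: le_trans (ler_wpM2l (dot_ge0 x) (frob_bound _ x)) _.
  rewrite fE exprMn -exprM mulrCA -expr2.
  by rewrite ler_wpM2r// sqr_ge0.
by rewrite -ler_sqr ?nnegrE ?dot_ge0// mulr_ge0 ?sqr_ge0 ?dot_ge0.
Qed.

Let row_sq_ge0 w : 0 <= row_sq w.
Proof. by apply: sumr_ge0 => i _; exact: sqr_ge0. Qed.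

(** The perturbation bound with w = eta a. Of the factor 10, one comes from replacing q/a by alpha
    and nine from the squared term; the summand 4 (|alpha| + 1) comes from 4 q w / a^2. *)
Lemma lambda_max_AN_approx w alpha eta : 0 < eta -> eta <= 4^-1 -> 1 <= a ->
  32 * (`|alpha| + 1) ^+ 2 <= eta * a ->
  `|(2 * theta)^-1 * (N1 ^- 2 * row_sq w) - alpha| <= eta ->
  fluct w ^+ 2 <= eta * a -> frob2 w <= (eta * a) ^+ 4 ->
  `|lambda_max (AN Z N w) - a - fluct w - alpha| <= (10 + 4 * (`|alpha| + 1)) * eta.
Proof.
move=> eta0 eta4 a1 al hQ hb hG.
set q := N1^-1 * row_sq w.
have q0 : 0 <= q by rewrite mulr_ge0// invr_ge0 ltW.
pose Q := q / a.
have QE : (2 * theta)^-1 * (N1 ^- 2 * row_sq w) = Q.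
  by rewrite /Q /q /a; field; rewrite !gt_eqF.
have Q0 : 0 <= Q by rewrite divr_ge0// ltW.
rewrite QE in hQ.
have Qq : Q <= `|alpha| + 1.
  by move: hQ; rewrite ler_norml; have := ler_norm alpha; lra.
have ea0 : 0 <= eta * a by rewrite mulr_ge0// ltW.
(* Its square is at most eta a <= a/4 <= a^2 / 4, because a >= 1. *)
have ba : `|fluct w| <= a / 2.
  rewrite -ler_sqr ?nnegrE ?normr_ge0 ?divr_ge0 ?(ltW a0)// real_normK ?num_real//.
  apply: le_trans hb _; rewrite expr_div_n -natrX ler_pdivlMr//.
  by have := a0; nra.
have wa : eta * a <= a / 4 by rewrite mulrC ler_pM2l.
have := @lambda_max_rank1_perturbation _ _ (Wm w) e a (eta * a) (ltn0Sn n) (WmT w) e1 a0 ea0 wa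
  (opnorm ea0 hG).
rewrite dot_eeW dot_eWeW -/q -AN_decomposition => /(_ ba).
rewrite -/Q.
have -> : 4 * q * (eta * a) / a ^+ 2 = 4 * Q * eta.
  by rewrite /Q; field; rewrite gt_eqF.
rewrite -[4 * q / a]mulrA -/Q.
(* 8 from the bound on [fluct], and 1 because the lower bound assumed on eta a absorbs 32 Q^2. *)
have h2 : (2 * `|fluct w| + 4 * Q) ^+ 2 / a <= 9 * eta.
  rewrite ler_pdivrMr//.
  have h3 : (2 * `|fluct w| + 4 * Q) ^+ 2 <= 8 * `|fluct w| ^+ 2 + 32 * Q ^+ 2.
    have := sqr_ge0 (2 * `|fluct w| - 4 * Q); nra.
  apply: le_trans h3 _; rewrite real_normK ?num_real//.
  have : Q ^+ 2 <= (`|alpha| + 1) ^+ 2 by rewrite ler_sqr ?nnegrE// addr_ge0.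
  lra.
have h4 : 4 * Q * eta <= 4 * (`|alpha| + 1) * eta.
  by rewrite ler_wpM2r ?(ltW eta0)// ler_wpM2l.
move: hQ; rewrite !ler_norml; lra.
Qed.

Let aN i j k l : all_moments P (fun w => noise i j w * noise k l w).
Proof. exact: all_moments_mul. Qed.

Let a_row i : all_moments P (row_noise i).
Proof. exact: all_moments_sum. Qed.

Let a_row_sq : all_moments P row_sq.
Proof. by apply: all_moments_sum => i; exact: all_moments_exp. Qed.

Let a_frob2 : all_moments P frob2.
Proof.
by apply: all_moments_sum => i; apply: all_moments_sum => k; apply: all_moments_exp;
  exact: all_moments_sum.
Qed.

Let a_fluct : all_moments P fluct.
Proof. by have [Vm _ _ _] := centered_span_gaussian; exact: Vm centered_span_fluct. Qed.

Lemma measurable_fluct x : measurable [set w | fluct w <= x].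
Proof. by apply: measurable_sublevel; exact: all_moments_measurable. Qed.

Lemma measurable_lambda_max_AN x : measurable [set w | lambda_max (AN Z N w) <= x].
Proof.
have AT w : (AN Z N w)^T = AN Z N w.
  by apply/matrixP => i j; rewrite !mxE addrC.
pose E (y : 'rV[rat]_N) := [set w | dot (map_mx ratr y) (map_mx ratr y *m AN Z N w) <=
                         x * dot (map_mx ratr y) (map_mx ratr y)].
have mE y : measurable (E y).
  apply: measurable_sublevel; apply: all_moments_measurable.
  under eq_fun do rewrite dotE.
  apply: all_moments_sum => i; apply: all_moments_scale.
  under eq_fun do rewrite mxE.
  apply: all_moments_sum => j; apply: all_moments_scale.
  by under eq_fun do rewrite mxE; exact: all_moments_add.
(* Rational row vectors are enumerated by their codes; integers that code no vector contribute the
   whole space. *)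
have -> : [set w | lambda_max (AN Z N w) <= x] =
    \bigcap_k (if (unpickle k : option 'rV[rat]_N) is Some y then E y else setT).
  apply/seteqP; split => w /= h.
    by move=> k _; case: unpickle => // y; exact: (lambda_max_leP x (ltn0Sn n) (AT w)).1.
  apply/(lambda_max_leP x (ltn0Sn n) (AT w)) => y.
  by have := h (pickle y) I; rewrite pickleK.
by apply: bigcap_measurableType => k _; case: unpickle.
Qed.

Let Qm := (2 * theta)^-1 * (N1 ^- 2 * mu).
Let Qf w := (2 * theta)^-1 * (N1 ^- 2 * row_sq w).

(** The failures of the three probabilistic hypotheses of [lambda_max_AN_approx]. The first
    threshold is eta / 2 because the other half is spent on the distance from [Qm] to alpha. *)
Definition bad_event (eta : R) : set T :=
  [set w | (eta / 2) ^+ 2 <= (Qf w - Qm) ^+ 2] `|`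
  ([set w | eta * a <= fluct w ^+ 2] `|` [set w | (eta * a) ^+ 4 <= frob2 w]).

(** Markov constants of the three events, with K = 4 M. Each event costs O(1/N): the first and third
    weigh N^3 against N^4, the second a bounded variance against N. *)
Definition bad_const (eta : R) : R :=
  (2 * (4 * M) ^+ 2) / ((2 * theta) ^+ 2 * (eta / 2) ^+ 2) +
  (4 * M / (2 * eta * theta) + 3 * (4 * M) ^+ 2 / (2 * eta * theta) ^+ 4).

Let a_dev : all_moments P (fun w => (Qf w - Qm) ^+ 2).
Proof.
apply: all_moments_exp; apply: all_moments_add; last exact: all_moments_cst.
by do 2 apply: all_moments_scale.
Qed.

Let mB1 eta : measurable [set w | (eta / 2) ^+ 2 <= (Qf w - Qm) ^+ 2].
Proof. by apply: measurable_superlevel; exact: all_moments_measurable. Qed.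

Let mB2 eta : measurable [set w | eta * a <= fluct w ^+ 2].
Proof.
by apply: measurable_superlevel; apply: all_moments_measurable; exact: all_moments_exp.
Qed.

Let mB3 eta : measurable [set w | (eta * a) ^+ 4 <= frob2 w].
Proof. by apply: measurable_superlevel; exact: all_moments_measurable. Qed.

Lemma measurable_bad_event eta : measurable (bad_event eta).
Proof. by apply: measurableU => //; exact: measurableU. Qed.

Lemma bad_event_prob eta : 0 < eta -> fine (P (bad_event eta)) <= bad_const eta / N1.
Proof.
move=> eta0.
have ea0 : 0 < eta * a by rewrite mulr_gt0.
have fin A : measurable A -> P A \is a fin_num by move=> mA; exact: fin_num_measure.
have sub A C : measurable A -> measurable C -> fine (P (A `|` C)) <= fine (P A) + fine (P C).
  move=> mA mC; rewrite -fineD ?fin// fine_le ?fin//; first exact: measurableU.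
    by rewrite fin_numD !fin.
  exact: measureU2.
have p1 : fine (P [set w | (eta / 2) ^+ 2 <= (Qf w - Qm) ^+ 2]) <=
    (2 * (4 * M) ^+ 2) / ((2 * theta) ^+ 2 * (eta / 2) ^+ 2) / N1.
  have e20 : 0 < (eta / 2) ^+ 2 by rewrite exprn_gt0// divr_gt0.
  apply: le_trans (Ex_markov a_dev (fun w => sqr_ge0 _) e20) _.
  have -> : Ex (fun w => (Qf w - Qm) ^+ 2) =
     (2 * theta) ^- 2 * N1 ^- 4 * Ex (fun w => (row_sq w - mu) ^+ 2).
    rewrite -ExZ; last first.
      by apply: all_moments_exp; apply: all_moments_add => //; exact: all_moments_cst.
    congr Ex; apply/funext => w; rewrite /Qf /Qm; field.
    by rewrite !gt_eqF.
  have := Var_sum_row_squares_le centered_span_gaussian centered_span_noise noise_row_bound V0.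
  rewrite -/(row_noise _) => h.
  rewrite ler_pdivrMr//.
  apply: le_trans (ler_wpM2l _ h) _.
    by rewrite mulr_ge0// invr_ge0 exprn_ge0// ltW// mulr_gt0.
  rewrite -/N1 le_eqVlt; apply/orP; left; apply/eqP; field.
  by rewrite !gt_eqF.
have p2 : fine (P [set w | eta * a <= fluct w ^+ 2]) <= 4 * M / (2 * eta * theta) / N1.
  apply: le_trans (Ex_markov (all_moments_exp 2 a_fluct) (fun w => sqr_ge0 _) ea0) _.
  rewrite ler_pdivrMr//; apply: le_trans Ex_fluct_sqr_le _.
  rewrite /a le_eqVlt; apply/orP; left; apply/eqP; field.
  by rewrite !gt_eqF.
have p3 : fine (P [set w | (eta * a) ^+ 4 <= frob2 w]) <=
     3 * (4 * M) ^+ 2 / (2 * eta * theta) ^+ 4 / N1.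
  have ea4 : 0 < (eta * a) ^+ 4 by rewrite exprn_gt0.
  have f0 w : 0 <= frob2 w by do 2 apply: sumr_ge0 => ? _; exact: sqr_ge0.
  apply: le_trans (Ex_markov a_frob2 f0 ea4) _.
  rewrite ler_pdivrMr//.
  apply: le_trans (Ex_frob_square_le centered_span_gaussian centered_span_noise noise_row_bound) _.
  rewrite -/N1 /a le_eqVlt; apply/orP; left; apply/eqP; field.
  by rewrite !gt_eqF.
rewrite /bad_event /bad_const mulrDl [X in _ + X]mulrDl.
apply: (le_trans (sub _ _ (mB1 eta) (measurableU _ _ (mB2 eta) (mB3 eta)))).
apply: lerD => //; apply: (le_trans (sub _ _ (mB2 eta) (mB3 eta))).
exact: lerD.
Qed.

End size.

(** * Limits as the size grows *)

Let alpha := (2 * theta)^-1 * sum1 (fun i => K i 0 + K 0 i).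

(** Each coordinate axis is part of the box, so absolute summability in two indices passes to the
    axes. *)
Let row1_bound m : zsum m (fun i => `|K i 0 + K 0 i|) <= 2 * M.
Proof.
have h1 : zsum m (fun i => `|K i 0|) <= M.
  apply: le_trans (KM m); apply: le_zsum => i.
  exact: (@zsum_center_le _ (fun j => `|K i j|)).
have h2 : zsum m (fun i => `|K 0 i|) <= M.
  apply: le_trans (KM m).
  apply: (@zsum_center_le _ (fun i => zsum m (fun j => `|K i j|))) => i.
  exact: zsum_ge0.
apply: (@le_trans _ _ (zsum m (fun i => `|K i 0| + `|K 0 i|))).
  by apply: le_zsum => i; exact: ler_normD.
by rewrite zsumD; lra.
Qed.

Lemma cvg_row_noise_mean :
  (fun n => (2 * theta)^-1 * (n.+1%:R ^- 2 *
     \sum_(i < n.+1) Ex (fun w => row_noise i w ^+ 2))) @ \oo --> alpha.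
Proof.
apply: cvgM; first exact: cvg_cst.
have c1 := cvg_mean_toeplitz row1_bound.
have c2 : (fun n => 2 * M / n.+1%:R) @ \oo --> (0 : R).
  rewrite -[X in _ --> X](mulr0 (2 * M)); apply: cvgM; first exact: cvg_cst.
  exact: cvg_harmonic.
pose A n : R := n.+1%:R ^- 2 * \sum_(i < n.+1) Ex (fun w => row_noise i w ^+ 2).
pose B n : R := n.+1%:R^-1 * \sum_(j < n.+1) \sum_(l < n.+1)
  (K (l%:Z - j%:Z) 0 + K 0 (l%:Z - j%:Z)).
have c3 : (fun n => A n - B n) @ \oo --> (0 : R).
  apply/cvgr0Pnorm_le => e e0; near=> n.
  apply: le_trans (row_noise_mean n) _.
  apply: le_trans (ler_norm _) _.
  by near: n; exact: cvgr0_norm_le.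
have cA : A @ \oo --> sum1 (fun i => K i 0 + K 0 i).
  have -> : A = (fun n => (A n - B n) + B n) by apply/funext => n; rewrite subrK.
  by rewrite -[X in _ --> X]add0r; apply: cvgD.
exact: cA.
Unshelve. all: by end_near. Qed.

Lemma cvg_Ex_fluct_sqr :
  (fun n => Ex (fun w => fluct n w ^+ 2)) @ \oo --> 4 * sum2 K.
Proof.
under eq_fun do rewrite Ex_fluct_sqr.
by apply: cvgM; [exact: cvg_cst|exact: cvg_mean2_toeplitz KM].
Qed.

(** A limit of variances is nonnegative. *)
Lemma sum2_cov_kernel_gt0 : sum2 K != 0 -> 0 < 4 * sum2 K.
Proof.
move=> K0; rewrite lt_neqAle eq_sym mulf_neq0//=.
apply: (ler_cvg_to (cvg_cst 0) cvg_Ex_fluct_sqr).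
by apply: nearW => n; apply: Ex_ge0 => w; exact: sqr_ge0.
Qed.

Lemma lambda_max_AN_clt (x : R) : sum2 K != 0 ->
  (fun n => fine (P [set w | lambda_max (AN Z n.+1 w) - 2 * n.+1%:R * theta <= x])) @ \oo -->
  std_cdf ((x - alpha) / Num.sqrt (4 * sum2 K)).
Proof.
move=> K0.
pose v n := Ex (fun w => fluct n w ^+ 2).
have cv : v @ \oo --> 4 * sum2 K := cvg_Ex_fluct_sqr.
have s0 := sum2_cov_kernel_gt0 K0.
apply: (@slutsky _ _ _ P (fun n w => lambda_max (AN Z n.+1 w) - 2 * n.+1%:R * theta)
  (fun n => fluct n) v) => //.
- move=> n y; have := measurable_lambda_max_AN n (y + 2 * n.+1%:R * theta).
  by congr (measurable _); apply/seteqP; split => w /=; rewrite lerBlDr.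
- by move=> n y; exact: measurable_fluct.
- near=> n; move=> t; apply: centered_span_cdf; first exact: centered_span_fluct.
  by near: n; exact: cvgr_gt cv _ s0.
move=> eps eps0.
set C := 10 + 4 * (`|alpha| + 1).
have C0 : 0 < C by rewrite /C; have := normr_ge0 alpha; lra.
(* At most 1/4 for the operator norm condition, and at most eps / C so that the final error is below
   eps. *)
pose eta := Num.min 4^-1 (eps / C).
have eta0 : 0 < eta by rewrite lt_min invr_gt0 ltr0n divr_gt0.
have eta4 : eta <= 4^-1 by rewrite ge_min lexx.
have etae : C * eta <= eps.
  by rewrite mulrC -ler_pdivlMr// ge_min lexx orbT.
exists (fun n => bad_event n eta); split.
- by move=> n; exact: measurable_bad_event.
- have c2 : (fun n => bad_const eta / n.+1%:R) @ \oo --> (0 : R).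
    rewrite -[X in _ --> X](mulr0 (bad_const eta)); apply: cvgM; first exact: cvg_cst.
    exact: cvg_harmonic.
  apply: (squeeze_cvgr _ (cvg_cst 0) c2); near=> n.
  by rewrite bad_event_prob// fine_ge0.
near=> n => w nB.
have c3 : `|alpha - (2 * theta)^-1 * (n.+1%:R ^- 2 *
     \sum_(i < n.+1) Ex (fun w => row_noise i w ^+ 2))| <= eta / 2.
  near: n; have /cvgrPdist_le/(_ (eta / 2)) := cvg_row_noise_mean; apply.
  by rewrite divr_gt0.
(* Chosen to yield both a >= 1 and 32 (|alpha| + 1)^2 <= eta a. *)
have nbig : (1 + 32 * (`|alpha| + 1) ^+ 2 / eta) / (2 * theta) <= n%:R.
  by near: n; exact: nbhs_infty_ger.
have abig : 1 + 32 * (`|alpha| + 1) ^+ 2 / eta <= 2 * n.+1%:R * theta.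
  move: nbig; rewrite ler_pdivrMr ?mulr_gt0// => /le_trans; apply.
  by rewrite mulrCA mulrA ler_pM2r// ler_pM2l// ler_nat.
have r0 : 0 <= 32 * (`|alpha| + 1) ^+ 2 / eta.
  by rewrite divr_ge0 ?(ltW eta0)// mulr_ge0 ?sqr_ge0.
move: nB => /not_orP[/negP n1 /not_orP[/negP n2 /negP n3]].
rewrite -!ltNge in n1 n2 n3.
apply: le_trans etae; apply: lambda_max_AN_approx => //.
- by lra.
- by rewrite [eta * _]mulrC -ler_pdivrMr//; lra.
- rewrite distrC; move: n1; rewrite -(@real_normK _ (_ - _)) ?num_real//.
  rewrite ltr_sqr ?nnegrE ?divr_ge0 ?(ltW eta0)//.
  move=> h; rewrite [leRHS]splitr; apply: le_trans (ler_distD _ _ _) (lerD c3 _).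
  by rewrite distrC ltW.
- exact: ltW.
- exact: ltW.
Unshelve. all: by end_near. Qed.

End process.

Theorem theorem1 (d : measure_display) (T : measurableType d) (R : realType)
  (P : probability T R) (Z : int -> int -> T -> R) (theta : R) :
  0 < theta ->
  gaussian_process P Z ->
  stationary_mean P Z theta ->
  abs_summable2 (cov_kernel P Z) ->
  sum2 (cov_kernel P Z) != 0 ->
  let alpha := (2 * theta)^-1 *
                 sum1 (fun i => cov_kernel P Z i 0 + cov_kernel P Z 0 i) in
  let sigma2 := 4 * sum2 (cov_kernel P Z) in
  forall x : R,
    (fun N : nat =>
       fine (P [set w | lambda_max (AN Z N w) - 2 * N%:R * theta <= x]))
    @ \oo --> fine (normal_prob alpha (Num.sqrt sigma2) `]-oo, x]).
Proof.
move=> theta0 GP SM [M KM] K0 alpha sigma2 x.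
have s0 : 0 < sigma2 by exact: (sum2_cov_kernel_gt0 theta0 GP SM KM K0).
(* The shift discards the empty matrix, so that every size is a successor; positivity of [sigma2]
   puts the limit law in its nondegenerate form. *)
rewrite -cvg_shiftS normal_prob_cdf; last by rewrite gt_eqF// sqrtr_gt0.
rewrite ger0_norm ?sqrtr_ge0//.
exact: (lambda_max_AN_clt theta0 GP SM KM K0).
Qed.
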